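(* Let $Y := Q^{-1/2} J T_{w_0}$, an invertible element of $\widetilde{U_q(\mathfrak g)}$. Then the unitarized $R$-matrix $\bar R$ of $U_q(\mathfrak g)$ can be realized as $$\bar R = (Y^{-1}\otimes Y^{-1})\,\Delta(Y).$$ That is, the two sides act by the same operator on $V\otimes W$ for all finite dimensional representations $V,W$ of $U_q(\mathfrak g)$.
   Context: **Quantum group.** $\mathfrak g$ is a complex simple Lie algebra with Cartan subalgebra $\mathfrak h$, Cartan matrix $(a_{ij})_{i,j\in I}$, simple roots $\alpha_i$, simple coroots $H_i=\alpha_i^\vee$, $\langle H_i,\alpha_j\rangle=a_{ij}$. $(\cdot,\cdot)$ is the usual invariant form on $\mathfrak h^*$, $d_i=(\alpha_i,\alpha_i)/2$ (positive integers with $(\alpha_i,\alpha_j)=d_ia_{ij}$, normalized so short roots have $d_i=1$), $q_i=q^{d_i}$. $P$ is the weight lattice, $P_+$ the dominant weights, $\rho$ satisfies $(\alpha_i,\rho)=d_i$ for all $i$. $U_q(\mathfrak g)$ is the quantized enveloping algebra over $\mathbb C(q)$ generated by $E_i,F_i$ ($i\in I$) and $K_H$ ($H$ in the coweight lattice), with $K_HK_{H'}=K_{H+H'}$, $K_HE_jK_H^{-1}=q^{\langle H,\alpha_j\rangle}E_j$, $K_HF_jK_H^{-1}=q^{-\langle H,\alpha_j\rangle}F_j$, $[E_i,F_j]=\delta_{ij}(K_i-K_i^{-1})/(q_i-q_i^{-1})$ where $K_i=K_{d_iH_i}$, and the quantum Serre relations. The coproduct is $\Delta E_i=E_i\otimes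 K_i+1\otimes E_i$, $\Delta F_i=F_i\otimes 1+K_i^{-1}\otimes F_i$, with $K_H$ grouplike. Divided powers are $E_i^{(n)}=E_i^n/[n]_{q_i}!$, $F_i^{(n)}=F_i^n/[n]_{q_i}!$, where $[n]_{q_i}=(q_i^n-q_i^{-n})/(q_i-q_i^{-1})$. Finite dimensional representations are of type 1, i.e. direct sums of the irreducibles $V_\lambda$ of highest weight $\lambda\in P_+$; a vector of weight $\mu$ satisfies $K_Hv=q^{\langle H,\mu\rangle}v$. Where fractional powers of $q$ occur, scalars are extended to $\mathbb C(q^{1/k})$ for a fixed sufficiently divisible $k$. **Completion.** $\widetilde{U_q(\mathfrak g)}$ is the completion of $U_q(\mathfrak g)$ in the weak topology of all matrix elements of finite dimensional representations; concretely $\widetilde{U_q(\mathfrak g)}\cong\prod_{\lambda\in P_+}\mathrm{End}(V_\lambda)$. It acts on every finite dimensional representation; for $u\in\widetilde{U_q(\mathfrak g)}$, $\Delta(u)$ is defined by the action of $u$ on tensor products $V\otimes W$. $\widetilde{U_q(\mathfrak g)\otimes U_q(\mathfrak g)}$ is the analogous completion of $U_q(\mathfrak g)\otimes U_q(\mathfrak g)$, acting on all $V\otimes W$. **Elements.** $T_i\in\widetilde{U_q(\mathfrak g)}$ acts on a weight vector $v$ by $$T_i(v)=\sum_{a,b,c\ge0,\ -a+b-c=\langle \mathrm{wt}(v),\alpha_i^\vee\rangle}(-1)^bq_i^{-ac+b}E_i^{(a)}F_i^{(b)}E_i^{(c)}v.$$ The $T_i$ satisfy the braid relations; $T_{w_0}=T_{i_1}\cdots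 T_{i_m}$ for any reduced word $w_0=s_{i_1}\cdots s_{i_m}$ of the longest Weyl group element. $J$ multiplies each vector of weight $\mu$ by $q^{(\mu,\mu)/2+(\mu,\rho)}$. $Q$ and its central square root $Q^{1/2}$ act on $V_\lambda$ by the scalars $q^{(\lambda,\lambda+2\rho)}$ and $q^{(\lambda,\lambda)/2+(\lambda,\rho)}$. **$R$-matrices.** The standard universal $R$-matrix $R$ (by a theorem of Kirillov–Reshetikhin and Levendorskii–Soibelman) is $$R=\Theta\,(T_{w_0}^{-1}\otimes T_{w_0}^{-1})\Delta(T_{w_0}),$$ where $\Theta=\exp\big(h\sum_{i,j}(B^{-1})_{ij}H_i\otimes H_j\big)$ with $B=(d_j^{-1}a_{ij})$, $q=e^h$, i.e. $\Theta$ multiplies $v\otimes w$ by $q^{(\mu,\nu)}$ if $v,w$ have weights $\mu,\nu$. It satisfies $R^{op}R=(Q^{-1}\otimes Q^{-1})\Delta(Q)$. The unitarized $R$-matrix is $\bar R:=R(R^{op}R)^{-1/2}$, i.e. $\bar R=R\,(Q^{1/2}\otimes Q^{1/2})\Delta(Q^{-1/2})$. *)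

(* Defs.v *)
From HB Require Import structures.
From mathcomp Require Import all_boot all_order all_algebra.
From mathcomp Require Import all_classical reals.
From mathcomp Require Import complex mxtens.
Set Implicit Arguments.
Unset Strict Implicit.
Unset Printing Implicit Defensive.
Import Order.TTheory GRing.Theory Num.Theory.
Local Open Scope classical_set_scope.
Local Open Scope ring_scope.

(* A complex simple Lie algebra enters only through its Cartan matrix and the
   root lengths.  Up to isomorphism, such algebras are the indecomposable
   Cartan matrices of finite type, i.e. those with a positive definite
   symmetrization (d_i a_ij); [short_root] normalizes the d_i so that the
   short roots have d_i = 1. *)
Record simple_datum := SimpleDatum {
  rank : nat;
  cartan : 'M[int]_rank;
  dlen : 'I_rank -> nat;
  cartan_diag : forall i, cartan i i = 2;
  cartan_offdiag : forall i j, i != j -> cartan i j <= 0;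
  dlen_gt0 : forall i, (0 < dlen i)%N;
  cartan_symm : forall i j,
    (dlen i)%:Z * cartan i j = (dlen j)%:Z * cartan j i;
  cartan_posdef : forall x : 'rV[rat]_rank, x != 0 ->
    0 < \sum_i \sum_j x 0 i * x 0 j * ((dlen i)%:Z * cartan i j)%:~R;
  cartan_indec : forall S : {set 'I_rank},
    (forall i j, i \in S -> j \notin S -> cartan i j = 0) ->
    S = finset.set0 \/ S = [set: 'I_rank]%SET;
  short_root : exists i, dlen i = 1%N }.

Section RootData.
Variable g : simple_datum.

(* The rational span of the roots in h^*, in the basis of simple roots. *)
Definition hdual := 'rV[rat]_(rank g).

(* The coweight lattice, in the basis of fundamental coweights: the
   coordinates of H are the integers <H, alpha_j>. *)
Definition coweight := 'rV[int]_(rank g).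

Definition alpha (i : 'I_(rank g)) : hdual := delta_mx 0 i.

Definition pairing (H : coweight) (mu : hdual) : rat :=
  \sum_j (H 0 j)%:~R * mu 0 j.

Definition coroot (i : 'I_(rank g)) : coweight := row i (cartan g).

Definition bform (mu nu : hdual) : rat :=
  \sum_i \sum_j mu 0 i * nu 0 j * ((dlen i)%:Z * cartan g i j)%:~R.

Definition weight (mu : hdual) : Prop :=
  forall i, pairing (coroot i) mu \is a Num.int.

Definition dominant (mu : hdual) : Prop :=
  weight mu /\ forall i, 0 <= pairing (coroot i) mu.

Definition srefl (i : 'I_(rank g)) (mu : hdual) : hdual :=
  mu - pairing (coroot i) mu *: alpha i.

Definition wact (s : seq 'I_(rank g)) : hdual -> hdual :=
  foldr (fun i f => srefl i \o f) id s.

Definition reduced (s : seq 'I_(rank g)) : Prop :=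
  forall s', wact s' =1 wact s -> (size s <= size s')%N.

Definition reduced_longest (s : seq 'I_(rank g)) : Prop :=
  reduced s /\ forall s', reduced s' -> (size s' <= size s)%N.

(* All powers of q that occur below are integral powers of q^(1/k). *)
Definition sufficiently_divisible (k : nat) : Prop :=
  [/\ (0 < k)%N,
      forall (H : coweight) mu, weight mu ->
        k%:R * pairing H mu \is a Num.int &
      forall mu, weight mu -> k%:R * (bform mu mu / 2) \is a Num.int].

End RootData.

Section QuantumGroup.
Variables (R : realType) (g : simple_datum) (k : nat).

Local Notation I := 'I_(rank g).

(* C(q^(1/k)): the indeterminate of the rational functions is q^(1/k). *)
Definition Kq := {fraction {poly R[i]}}.

(* q^x, for x a rational number with k x an integer. *)
Definition qpow (x : rat) : Kq :=
  tofrac ('X : {poly R[i]}) ^ Num.floor (k%:R * x).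

Definition qd (i : I) : Kq := qpow (dlen i)%:R.

Definition qnum (x : Kq) (n : nat) : Kq := (x ^+ n - x ^- n) / (x - x^-1).

Definition qfact (x : Kq) (n : nat) : Kq := \prod_(1 <= m < n.+1) qnum x m.

(* Operators by which the generators of U_q(g) act on Kq^n (column vectors). *)
Record action (n : nat) := Action {
  actE : I -> 'M[Kq]_n;
  actF : I -> 'M[Kq]_n;
  actK : coweight g -> 'M[Kq]_n }.

Definition actKi n (V : action n) (i : I) : 'M[Kq]_n :=
  actK V ((dlen i)%:Z *: coroot i).

Definition divE n (V : action n) (i : I) (a : nat) : 'M[Kq]_n :=
  (qfact (qd i) a)^-1 *: actE V i ^+ a.

Definition divF n (V : action n) (i : I) (a : nat) : 'M[Kq]_n :=
  (qfact (qd i) a)^-1 *: actF V i ^+ a.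

Definition serre_len (i j : I) : nat := `|1 - cartan g i j|%N.

(* The defining relations of U_q(g), i.e. the action of the generators extends
   to a representation of U_q(g) with scalars extended to C(q^(1/k)). *)
Record is_rep n (V : action n) : Prop := IsRep {
  rep_K0 : actK V 0 = 1%:M;
  rep_KD : forall H H', actK V H *m actK V H' = actK V (H + H');
  rep_KE : forall H j, actK V H *m actE V j *m invmx (actK V H)
    = qpow (pairing H (alpha j)) *: actE V j;
  rep_KF : forall H j, actK V H *m actF V j *m invmx (actK V H)
    = qpow (- pairing H (alpha j)) *: actF V j;
  rep_EF : forall i j, actE V i *m actF V j - actF V j *m actE V i
    = if i == j then
        (qd i - (qd i)^-1)^-1 *: (actKi V i - invmx (actKi V i))
      else 0;
  rep_serreE : forall i j, i != j ->
    \sum_(m < (serre_len i j).+1) (-1) ^+ m *: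
      (divE V i m *m actE V j *m divE V i (serre_len i j - m)) = 0;
  rep_serreF : forall i j, i != j ->
    \sum_(m < (serre_len i j).+1) (-1) ^+ m *:
      (divF V i m *m actF V j *m divF V i (serre_len i j - m)) = 0 }.

Definition weight_vector n (V : action n) (mu : hdual g) (v : 'cV[Kq]_n) :=
  weight mu /\ forall H, actK V H *m v = qpow (pairing H mu) *: v.

Definition stable n (V : action n) (S : {vspace 'cV[Kq]_n}) : Prop :=
  forall v, v \in S ->
  [/\ forall i, actE V i *m v \in S,
      forall i, actF V i *m v \in S &
      forall H, actK V H *m v \in S].

(* S is a subrepresentation of V isomorphic to V_lambda. *)
Definition irreducible_hw n (V : action n) (lambda : hdual g)
    (S : {vspace 'cV[Kq]_n}) : Prop :=
  [/\ dominant lambda,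
      stable V S,
      forall S', stable V S' -> (S' <= S)%VS -> S' = 0%VS \/ S' = S &
      exists v, [/\ v \in S, v != 0, weight_vector V lambda v &
                    forall i, actE V i *m v = 0]].

(* Finite dimensional representations of type 1. *)
Definition fdrep n (V : action n) : Prop :=
  is_rep V /\
  exists (m : nat) (lambda : 'I_m -> hdual g) (S : 'I_m -> {vspace 'cV[Kq]_n}),
    [/\ forall j, irreducible_hw V (lambda j) (S j),
        directv (\sum_j S j) &
        (\sum_j S j)%VS = fullv].

Definition intertwiner n m (V : action n) (W : action m) (f : 'M[Kq]_(m, n)) :=
  [/\ forall i, f *m actE V i = actE W i *m f,
      forall i, f *m actF V i = actF W i *m f &
      forall H, f *m actK V H = actK W H *m f].

(* V (x) W, through the coproduct
     Delta E_i = E_i (x) K_i + 1 (x) E_i,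
     Delta F_i = F_i (x) 1 + K_i^-1 (x) F_i,
     Delta K_H = K_H (x) K_H. *)
Definition tensor n m (V : action n) (W : action m) : action (n * m) :=
  Action (fun i => actE V i *t actKi W i + 1%:M *t actE W i)
         (fun i => actF V i *t 1%:M + invmx (actKi V i) *t actF W i)
         (fun H => actK V H *t actK W H).

(* Families of operators on the spaces V, resp. V (x) W. *)
Definition op1 := forall n, action n -> 'M[Kq]_n.
Definition op2 := forall n m, action n -> action m -> 'M[Kq]_(n * m).

(* The product of the End(V_lambda), lambda in P_+, identified with the
   families of operators on all finite dimensional representations that commute
   with all intertwiners. *)
Definition in_completion (u : op1) : Prop :=
  forall n m (V : action n) (W : action m) (f : 'M[Kq]_(m, n)),
    fdrep V -> fdrep W -> intertwiner V W f -> f *m u n V = u m W *m f.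

Definition mul1 (u u' : op1) : op1 := fun n V => u n V *m u' n V.
Definition inv1 (u : op1) : op1 := fun n V => invmx (u n V).
Definition mul2 (u u' : op2) : op2 := fun n m V W => u n m V W *m u' n m V W.
Definition otimes (u u' : op1) : op2 := fun n m V W => u n V *t u' m W.
Definition Delta (u : op1) : op2 := fun n m V W => u (n * m)%N (tensor V W).

Definition invertible_in_completion (u : op1) : Prop :=
  [/\ in_completion u, in_completion (inv1 u) &
      forall n (V : action n), fdrep V ->
        u n V *m inv1 u V = 1%:M /\ inv1 u V *m u n V = 1%:M].

(* The operator acting on vectors v of weight mu by v |-> f mu v. *)
Definition weight_op n (V : action n)
    (f : hdual g -> 'cV[Kq]_n -> 'cV[Kq]_n) : 'M[Kq]_n :=
  xget 0 [set M : 'M[Kq]_n |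
    forall mu v, weight_vector V mu v -> M *m v = f mu v].

(* The operator commuting with U_q(g) and acting on each V_lambda in V by
   c lambda. *)
Definition central_op n (V : action n) (c : hdual g -> Kq) : 'M[Kq]_n :=
  xget 0 [set M : 'M[Kq]_n | intertwiner V V M /\
    forall lambda S, irreducible_hw V lambda S ->
      forall v, v \in S -> M *m v = c lambda *: v].

(* The bounds a, b, c < n lose nothing: E_i^n = F_i^n = 0 on a representation
   of dimension n that is spanned by its weight vectors. *)
Definition T (i : I) : op1 := fun n V =>
  weight_op V (fun mu v =>
    \sum_(a < n) \sum_(b < n)
    \sum_(c < n | (b%:Z - a%:Z - c%:Z)%:~R == pairing (coroot i) mu)
      ((-1) ^+ b * qd i ^ (b%:Z - (a * c)%N%:Z)) *:
        (divE V i a *m (divF V i b *m (divE V i c *m v)))).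

Definition Tword (s : seq I) : op1 := fun n V =>
  foldr (fun i M => T i V *m M) 1%:M s.

(* rho is the element of h^* with (alpha_i, rho) = d_i for all i. *)
Definition J (rho : hdual g) : op1 := fun n V =>
  weight_op V (fun mu v => qpow (bform mu mu / 2 + bform mu rho) *: v).

Definition Qhalf (rho : hdual g) : op1 := fun n V =>
  central_op V (fun lambda =>
    qpow (bform lambda lambda / 2 + bform lambda rho)).

Definition Theta : op2 := fun n m V W =>
  xget 0 [set M : 'M[Kq]_(n * m) |
    forall mu nu (v : 'cV[Kq]_n) (w : 'cV[Kq]_m),
      weight_vector V mu v -> weight_vector W nu w ->
      M *m ((v *t w) : 'cV[Kq]_(n * m)) =
        qpow (bform mu nu) *: ((v *t w) : 'cV[Kq]_(n * m))].

(* The standard universal R-matrix; s is a reduced word of w_0. *)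
Definition Rmat (s : seq I) : op2 :=
  mul2 Theta (mul2 (otimes (inv1 (Tword s)) (inv1 (Tword s)))
                   (Delta (Tword s))).

(* R (R^op R)^(-1/2), where R^op R = (Q^-1 (x) Q^-1) Delta(Q). *)
Definition Rbar (rho : hdual g) (s : seq I) : op2 :=
  mul2 (Rmat s) (mul2 (otimes (Qhalf rho) (Qhalf rho))
                      (Delta (inv1 (Qhalf rho)))).

Definition Y (rho : hdual g) (s : seq I) : op1 :=
  mul1 (inv1 (Qhalf rho)) (mul1 (J rho) (Tword s)).

End QuantumGroup.

(* Main.v *)
Require Import Defs.
From mathcomp Require Import all_boot all_order all_algebra.
From mathcomp Require Import all_classical reals.
From mathcomp Require Import complex mxtens ring lra zify.
Set Implicit Arguments.
Unset Strict Implicit.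
Unset Printing Implicit Defensive.
Import Order.TTheory GRing.Theory Num.Theory.
Local Open Scope ring_scope.

(** The computation behind the statement is short.  Write [S] for the square
    root of [Q].  As [S] is central, it commutes with [J] and [T_w0], the pair
    [S (x) S] commutes with [Delta J] and [Delta T_w0], and so does
    [Delta S^-1].  Collecting these factors on the right,

      (Y^-1 (x) Y^-1) Delta(Y)
        = (T^-1 (x) T^-1) (J^-1 (x) J^-1) Delta(J) Delta(T) (S (x) S) Delta(S^-1).

    On vectors of weights [mu] and [nu] the factor [(J^-1 (x) J^-1) Delta(J)]
    is the scalar [q^(mu, nu)]: the quadratic form polarizes, and the term
    [(mu, rho)] is additive and cancels.  So this factor is [Theta] ([ThetaE]).
    Since [T_w0] maps the weight space of [mu] to that of [w0 mu] and the form
    is Weyl-invariant, [Theta] commutes with [T (x) T] ([Tword_Theta]), and can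
    be moved to the left, where it completes the standard R-matrix.  This is
    [unitarization_algebra] together with [Rbar_coboundary].

    Two points need real work, both because the operators are given by their
    values on weight vectors or on irreducible subrepresentations.

    The first is that [Y] is invertible, which comes down to the injectivity of
    each [T_i].  This is a statement about one quantum [sl_2], settled in
    [Tsum_eq0].  The defining triple sum commutes with the Casimir operator, so
    an induction on the nilpotency order of [E] reduces the question to a weight
    vector [v] that is a Casimir eigenvector.  Such a [v] is a multiple of
    [F^j u] for a singular vector [u] of some weight [M >= j], and the sum maps
    [F^j u] to a scalar multiple of [F^(M - j) u].  In that scalar the sum over
    the exponent of the left factor [E] is a [j]-th q-difference of a polynomial
    of degree [j - c], where [c] is the exponent of the right factor [E].  By
    the q-binomial theorem it vanishes unless [c = 0], and for [c = 0] it is a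
    product of nonzero factors ([Tsum_string]).

    The second is that [S] exists, is invertible and commutes with all
    intertwiners.  A finite dimensional representation is by hypothesis a direct
    sum of irreducible ones, so a statement about intertwiners can be tested on
    singular vectors ([fdrep_ext]); and in an irreducible representation the
    weight of a singular vector is unique ([irreducible_singular]).

    On [V (x) W] itself everything is tested on tensor products of weight
    vectors, which span ([tensor_ext]); and [Delta(S^-1)] commutes with
    [Delta(J)] and [Delta(T)] because on every representation the operator
    defining [S] commutes with the action ([central_op_intertwiner]). *)

(** * Quantum integers *)

Section QuantumIntegers.
Variables (L : fieldType) (x : L).

(** The quantum integer [[z]], for [z] of either sign: the weights of
    representations enter with both signs. *)
Definition qint (z : int) : L := (x ^ z - x ^ (- z)) / (x - x^-1).

Definition qfac (n : nat) : L := \prod_(1 <= m < n.+1) qint m.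

(** The q-binomial coefficient, as a falling product over a factorial; it is
    [0] for [0 <= z < a] because the product then contains [[0]]. *)
Definition qbin (z : int) (a : nat) : L :=
  (\prod_(i < a) qint (z - i%:Z)) / qfac a.

Hypothesis x0 : x != 0.
Hypothesis x_tors : forall n, (0 < n)%N -> x ^+ n != 1.

Lemma qint0 : qint 0 = 0.
Proof. by rewrite /qint oppr0 subrr mul0r. Qed.

Lemma x_subV_neq0 : x - x^-1 != 0.
Proof.
apply: contra_neq (x_tors (isT : 0 < 2)%N) => /eqP; rewrite subr_eq0 => /eqP e.
by rewrite expr2 {1}e mulVf.
Qed.

Lemma qint_eq0 z : (qint z == 0) = (z == 0).
Proof.
have H (n : nat) : (0 < n)%N -> x ^ n%:Z - x ^ (- n%:Z) != 0.
  move=> n0; have n20 : (0 < n + n)%N by rewrite addn_gt0 n0.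
  apply: contra_neq (x_tors n20) => /eqP; rewrite subr_eq0 => /eqP e.
  by rewrite exprnP PoszD expfzDr // {1}e -expfzDr // addNr expr0z.
rewrite /qint mulf_eq0 invr_eq0 (negbTE x_subV_neq0) orbF.
case: z => [[|n]|n]; first by rewrite oppr0 subrr !eqxx.
  by apply/negbTE; apply: H.
rewrite NegzE opprK; apply/negbTE.
by rewrite -opprB oppr_eq0; apply: H.
Qed.

Lemma qfac0 : qfac 0 = 1.
Proof. by rewrite /qfac big_geq. Qed.

Lemma qfacS n : qfac n.+1 = qfac n * qint n.+1.
Proof. by rewrite /qfac big_nat_recr. Qed.

Lemma qfac_neq0 n : qfac n != 0.
Proof.
elim: n => [|n IH]; first by rewrite qfac0 oner_eq0.
by rewrite qfacS mulf_neq0 // qint_eq0.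
Qed.

Lemma qintE z : qint z = (x ^ z - (x ^ z)^-1) / (x - x^-1).
Proof. by rewrite invr_expz. Qed.

Lemma expxDr (m n : int) : x ^ (m + n) = x ^ m * x ^ n.
Proof. exact: expfzDr. Qed.

Lemma expxN (m : int) : x ^ (- m) = (x ^ m)^-1.
Proof. by rewrite invr_expz. Qed.

Lemma expx_neq0 (m : int) : x ^ m != 0.
Proof. exact: expfz_neq0. Qed.

Lemma xsq_sub1_neq0 : x ^+ 2 - 1 != 0.
Proof. by rewrite subr_eq0 x_tors. Qed.

(** The induction step along a string: [[E, F]] adds [[m - 2 j]] to the
    coefficient [[j] [m - j + 1]] of [F E]. *)
Lemma qint_string (j m : int) :
  qint j * qint (m - j + 1) + qint (m - j - j) = qint (j + 1) * qint (m - j).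
Proof.
rewrite !qintE !expxDr !expxN expr1z.
have := expx_neq0 j; have := expx_neq0 m; have := xsq_sub1_neq0.
move: (x ^ m) (x ^ j) => u v xn un vn.
by field; rewrite x0 un vn xn.
Qed.

Lemma qint_pascal (j a : int) :
  qint (j + 1) = x ^ (a + 1) * qint (j - a) + x ^ (a - j) * qint (a + 1).
Proof.
rewrite !qintE !expxDr !expxN expr1z.
have := expx_neq0 j; have := expx_neq0 a; have := xsq_sub1_neq0.
move: (x ^ a) (x ^ j) => u v xn un vn.
by field; rewrite x0 un vn xn.
Qed.

(** The value of the Casimir element
    [F E + (x K + x^-1 K^-1) / (x - x^-1)^2] on a singular vector of weight
    [p]. *)
Definition casimir_scalar (p : int) : L :=
  (x ^ (p + 1) + x ^ (- (p + 1))) / (x - x^-1) ^+ 2.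

Lemma casimirD2 p : casimir_scalar (p + 2) = casimir_scalar p + qint (p + 2).
Proof.
rewrite /casimir_scalar qintE expxN !expxDr expxN !expxDr expr1z.
have := expx_neq0 p; have := xsq_sub1_neq0.
move: (x ^ p) => u xn un.
by field; rewrite x0 un xn.
Qed.

Lemma casimir_sub (m j : int) :
  casimir_scalar m - casimir_scalar (m - j - j) = qint j * qint (m - j + 1).
Proof.
rewrite /casimir_scalar !qintE !expxN !expxDr !expxN expr1z.
have := expx_neq0 m; have := expx_neq0 j; have := xsq_sub1_neq0.
move: (x ^ m) (x ^ j) => u v xn un vn.
by field; rewrite x0 un vn xn.
Qed.

Lemma qbin0r z : qbin z 0 = 1.
Proof. by rewrite /qbin big_ord0 qfac0 divr1. Qed.

Lemma qbin_gt (j a : nat) : (j < a)%N -> qbin j a = 0.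
Proof.
by move=> ja; rewrite /qbin (bigD1 (Ordinal ja)) //= subrr qint0 !mul0r.
Qed.

Lemma qbin_pascal (j : int) (a : nat) :
  qbin (j + 1) a.+1 = x ^ (a%:Z + 1) * qbin j a.+1 + x ^ (a%:Z - j) * qbin j a.
Proof.
rewrite /qbin big_ord_recl [in X in _ * X + _]big_ord_recr /= subr0 qfacS.
rewrite (eq_bigr (fun i : 'I_a => qint (j - i%:Z))); last first.
  by move=> i _; congr qint; rewrite /bump /=; lia.
set P := \prod_(i < a) _; have an := qfac_neq0 a.
have bn : qint a.+1 != 0 by rewrite qint_eq0.
rewrite (qint_pascal j a%:Z) -[a%:Z + 1]/(a + 1)%N%:Z addn1.
by field; rewrite an bn.
Qed.

(** Gauss's q-binomial theorem: by the Pascal rule the sum for [j + 1] at [z] is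
    [1 - x^-j z] times the sum for [j] at [x z]. *)
Lemma qbin_theorem (j : nat) (z : L) :
  \sum_(a < j.+1) (-1) ^+ a * qbin j a * z ^+ a =
  \prod_(i < j) (1 - x ^ (1 - j%:Z + (2 * i)%N%:Z) * z).
Proof.
elim: j z => [|j IH] z.
  by rewrite big_ord_recl !big_ord0 qbin0r expr0 !mulr1 addr0.
have -> : \sum_(a < j.+2) (-1) ^+ a * qbin j.+1 a * z ^+ a =
  (1 - x ^ (- j%:Z) * z) *
     \sum_(a < j.+1) (-1) ^+ a * qbin j a * (x * z) ^+ a.
  rewrite mulrBl mul1r mulr_sumr big_ord_recl expr0 !mul1r qbin0r mulr1.
  rewrite (eq_bigr (fun a : 'I_j.+1 =>
     (-1) ^+ a.+1 * qbin j a.+1 * (x * z) ^+ a.+1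
      - x ^ (- j%:Z) * z * ((-1) ^+ a * qbin j a * (x * z) ^+ a))).
    rewrite sumrB addrA; congr (_ - _).
    rewrite big_ord_recr /= qbin_gt // mulr0 mul0r addr0.
    rewrite [in RHS]big_ord_recl /= qbin0r !expr0 !mulr1.
    by congr (_ + _); apply: eq_bigr => i _; rewrite lift0.
  move=> a _; rewrite lift0 intS addrC qbin_pascal expxDr expxDr expr1z.
  by rewrite !exprMn !exprS -!exprnP; ring.
rewrite IH [in RHS]big_ord_recl muln0 addr0; congr (_ * _).
  by congr (1 - x ^ _ * z); lia.
apply: eq_bigr => i _; rewrite mulrA -{2}[x]expr1z -expxDr.
by congr (1 - x ^ _ * z); rewrite lift0; lia.
Qed.

(** The [j]-th q-difference of a polynomial of degree at most [j] only sees its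
    coefficient of degree [j]: on a monomial of degree [t] the q-binomial
    theorem turns it into a product that has a factor [1 - x^0] when
    [t < j]. *)
Lemma qdifference (j : nat) (P : {poly L}) : (size P <= j.+1)%N ->
  \sum_(a < j.+1) (-1) ^+ a * qbin j a * x ^ (a%:Z * (1 - j%:Z)) * P.[x ^+ (2 * a)]
  = P`_j * \prod_(i < j) (1 - x ^+ (2 * i.+1)).
Proof.
move=> sP.
pose S t := \sum_(a < j.+1)
   (-1) ^+ a * qbin j a * (x ^ (1 - j%:Z + (2 * t)%N%:Z)) ^+ a.
transitivity (\sum_(t < j.+1) P`_t * S t).
  under [RHS]eq_bigr do rewrite mulr_sumr.
  rewrite exchange_big /=; apply: eq_bigr => a _.
  rewrite (horner_coef_wide _ sP) mulr_sumr; apply: eq_bigr => t _.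
  rewrite exprnP exprz_exp mulrDl expxDr [a%:Z * _]mulrC -exprM mulnAC.
  by rewrite -PoszM -exprnP; ring.
rewrite big_ord_recr /= big1 ?add0r => [|t _].
  rewrite /S qbin_theorem; congr (_ * _).
  apply: eq_bigr => i _; rewrite -expxDr exprnP; congr (1 - x ^ _).
  by lia.
rewrite /S qbin_theorem (bigD1 (rev_ord t)) //=.
rewrite -expxDr [X in x ^ X](_ : _ = 0) ?expr0z ?subrr ?mul0r ?mulr0 //.
by have := ltn_ord t; rewrite /=; lia.
Qed.

Lemma qfac_ratio (n a : nat) :
  \prod_(i < a) qint ((n + a)%N%:Z - i%:Z) = qfac (n + a) / qfac n.
Proof.
elim: a => [|a IH]; first by rewrite big_ord0 addn0 divff // qfac_neq0.
rewrite big_ord_recl subr0 addnS [in RHS]qfacS [in RHS]mulrAC -IH [RHS]mulrC.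
by congr (_ * _); apply: eq_bigr => i _; congr qint; rewrite lift0; lia.
Qed.

Lemma qbin_rev (j a : nat) :
  \prod_(i < a) qint (j%:Z - a%:Z + i%:Z + 1) = qbin j a * qfac a.
Proof.
rewrite /qbin divfK ?qfac_neq0 // (reindex_inj rev_ord_inj).
by apply: eq_bigr => i _; congr qint; have := ltn_ord i; rewrite /=; lia.
Qed.

Lemma coef_prod_linear (d : nat) (a b : nat -> L) :
  let P := \prod_(i < d) (a i *: 'X - (b i)%:P) in
  (size P <= d.+1)%N /\ P`_d = \prod_(i < d) a i.
Proof.
elim: d => [|d [sP cP]] /=; first by rewrite !big_ord0 size_poly1 coef1.
rewrite !big_ord_recr /=; move: sP cP; set P := \prod_(i < d) _ => sP cP.
split.
  apply: leq_trans (size_polyMleq _ _) _.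
  have : (size (a d *: 'X - (b d)%:P)%R <= 2)%N.
    apply: leq_trans (size_polyD _ _) _; rewrite size_polyN geq_max.
    rewrite (leq_trans (size_scale_leq _ _)) ?size_polyX //.
    by rewrite (leq_trans (size_polyC_leq1 _)).
  by move: sP; lia.
rewrite mulrBr -scalerAr coefB coefZ coefMX coefMC /= cP.
by rewrite [P`_d.+1]nth_default // mul0r subr0 mulrC.
Qed.

(** The product [[n + a] [n + a - 1] ...] of [d] quantum integers is, up to a
    power of [x], the value of this polynomial at [x ^+ (2 * a)]; this puts it
    into the form that [qdifference] handles. *)
Definition qfall_poly (n d : nat) : {poly L} :=
  \prod_(i < d) ((x ^ (n%:Z - i%:Z) / (x - x^-1)) *: 'X
                  - (x ^ (i%:Z - n%:Z) / (x - x^-1))%:P).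

Lemma qfall_polyE (n d a : nat) :
  \prod_(i < d) qint ((n + a)%N%:Z - i%:Z)
  = x ^ (- (a * d)%N%:Z) * (qfall_poly n d).[x ^+ (2 * a)].
Proof.
elim: d => [|d IH].
  by rewrite /qfall_poly !big_ord0 muln0 hornerC mulr1.
rewrite /qfall_poly !big_ord_recr /= -/(qfall_poly n d) IH hornerM !hornerE.
rewrite mulnS !PoszD opprD expxDr /qint.
have := x_subV_neq0; move: (x - x^-1) => z z0.
have e : x ^+ (2 * a) = x ^ a%:Z * x ^ a%:Z.
  by rewrite -expxDr exprnP; congr (x ^ _); lia.
rewrite e !(expxN, expxDr).
have := expx_neq0 a; have := expx_neq0 n; have := expx_neq0 d.
have := expx_neq0 (a * d)%N; move: (qfall_poly n d).[_] => h.
move: (x ^ a%:Z) (x ^ n%:Z) (x ^ d%:Z) (x ^ (a * d)%N%:Z) => u v w t tn wn vn un.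
change (t^-1 * h * (v * u / w - (v * u)^-1 / w^-1) * z^-1 =
        (u * t)^-1 * h * (v / w / z * (u * u) - w / v / z)).
by field; rewrite z0 vn wn tn un oner_neq0.
Qed.

Lemma qfall_poly_size n d : (size (qfall_poly n d) <= d.+1)%N.
Proof.
by have [] := coef_prod_linear d (fun i => x ^ (n%:Z - i%:Z) / (x - x^-1))
  (fun i => x ^ (i%:Z - n%:Z) / (x - x^-1)).
Qed.

Lemma qfall_poly_lead n d : (qfall_poly n d)`_d != 0.
Proof.
have [_ ->] := coef_prod_linear d (fun i => x ^ (n%:Z - i%:Z) / (x - x^-1))
  (fun i => x ^ (i%:Z - n%:Z) / (x - x^-1)).
apply/prodf_neq0 => i _.
by rewrite mulf_neq0 ?invr_eq0 ?x_subV_neq0 ?expx_neq0.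
Qed.

End QuantumIntegers.

(** * The braid sum on a representation of quantum sl2 *)

Section IterLinear.
Variables (L : fieldType) (V : lmodType L) (G : {linear V -> V}).

Lemma iter_linearZ a c v : iter a G (c *: v) = c *: iter a G v.
Proof. by elim: a => //= a ->; rewrite linearZ. Qed.

Lemma iter_linear0 a : iter a G 0 = 0.
Proof. by elim: a => //= a ->; rewrite linear0. Qed.

Lemma iter_linearD a u v : iter a G (u + v) = iter a G u + iter a G v.
Proof. by elim: a => //= a ->; rewrite linearD. Qed.

Lemma iter_linear_ge n a v : iter n G v = 0 -> (n <= a)%N -> iter a G v = 0.
Proof.
by move=> Gn /subnK <-; rewrite iterD Gn iter_linear0.
Qed.

End IterLinear.

(** The weight spaces and the commutation of [E] with [F] on them are taken as
    the hypotheses; [wt p v] is meant to say that [v] has weight [p], and [N]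
    bounds the nilpotency orders of [E] and [F]. *)
Section SL2.
Variables (L : fieldType) (x : L).
Hypothesis x0 : x != 0.
Hypothesis x_tors : forall n, (0 < n)%N -> x ^+ n != 1.
Variables (V : lmodType L) (E F : {linear V -> V}) (wt : int -> V -> Prop).
Variable N : nat.
Hypothesis wtD : forall p u v, wt p u -> wt p v -> wt p (u + v).
Hypothesis wtZ : forall p c v, wt p v -> wt p (c *: v).
Hypothesis wtE : forall p v, wt p v -> wt (p + 2) (E v).
Hypothesis wtF : forall p v, wt p v -> wt (p - 2) (F v).
Hypothesis EF : forall p v, wt p v -> E (F v) = F (E v) + qint x p *: v.
Hypothesis EN : forall v, iter N E v = 0.
Hypothesis FN : forall v, iter N F v = 0.

Local Notation qi := (qint x).
Local Notation qf := (qfac x).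

Lemma wt_iterE p v a : wt p v -> wt (p + (2 * a)%N%:Z) (iter a E v).
Proof.
move=> pv; elim: a => [|a IH]; first by rewrite muln0 addr0.
by have := wtE IH; congr (wt _ _); lia.
Qed.

Lemma wt_iterF p v a : wt p v -> wt (p - (2 * a)%N%:Z) (iter a F v).
Proof.
move=> pv; elim: a => [|a IH]; first by rewrite muln0 subr0.
by have := wtF IH; congr (wt _ _); lia.
Qed.

Lemma string_actE (m : int) (u : V) (j : nat) : wt m u -> E u = 0 ->
  E (iter j.+1 F u) = (qi j.+1 * qi (m - j%:Z)) *: iter j F u.
Proof.
move=> um Eu; elim: j => [|j IH].
  by rewrite (EF um) Eu linear0 add0r subr0 /qint divff ?mul1r ?x_subV_neq0.
rewrite [iter j.+2 F u]iterS (EF (wt_iterF _ um)) IH linearZ -iterS -scalerDl.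
congr (_ *: _); have := qint_string x0 x_tors j.+1 m.
rewrite (_ : m - j.+1%:Z + 1 = m - j%:Z); last lia.
rewrite (_ : m - (2 * j.+1)%N%:Z = m - j.+1%:Z - j.+1%:Z); last lia.
by move=> ->; congr (qi _ * _); lia.
Qed.

(** For a negative weight no coefficient of [string_actE] vanishes, so the
    string [F^j u] would never end. *)
Lemma singular_ge0 (m : int) (u : V) : wt m u -> E u = 0 -> u != 0 -> 0 <= m.
Proof.
move=> um Eu un; rewrite leNgt; apply/negP => m0.
suff H j : iter j F u != 0 by have := H N; rewrite FN eqxx.
elim: j => // j IH; apply: contra_neq IH => e.
have := string_actE j um Eu; rewrite e linear0 => /esym/eqP.
rewrite scaler_eq0 mulf_eq0 !qint_eq0 //.
by case/orP => [/orP[] /eqP|/eqP //]; lia.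
Qed.

(** The Casimir element, restricted to vectors of weight [p]; there its Cartan
    part is a scalar. *)
Definition casimir_op (p : int) (v : V) := F (E v) + casimir_scalar x p *: v.

Lemma wt_casimir_op p v : wt p v -> wt p (casimir_op p v).
Proof.
move=> pv; apply: wtD; last exact: wtZ.
by have := wtF (wtE pv); congr (wt _ _); lia.
Qed.

Lemma E_casimir_op p v : wt p v -> E (casimir_op p v) = casimir_op (p + 2) (E v).
Proof.
move=> pv; rewrite /casimir_op linearD linearZ (EF (wtE pv)) casimirD2 // scalerDl.
by rewrite -addrA; congr (_ + _); rewrite addrC.
Qed.

Lemma F_casimir_op p v : wt p v -> F (casimir_op p v) = casimir_op (p - 2) (F v).
Proof.
move=> pv; rewrite /casimir_op linearD linearZ (EF pv) linearD linearZ -addrA.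
rewrite -scalerDl; congr (_ + _ *: _).
by rewrite -{1}(subrK 2 p) casimirD2 // subrK addrC.
Qed.

Lemma iterE_casimir_op p v a : wt p v ->
  iter a E (casimir_op p v) = casimir_op (p + (2 * a)%N%:Z) (iter a E v).
Proof.
move=> pv; elim: a => [|a IH]; first by rewrite muln0 addr0.
rewrite /= IH E_casimir_op; first by congr casimir_op; lia.
exact: wt_iterE.
Qed.

Lemma iterF_casimir_op p v a : wt p v ->
  iter a F (casimir_op p v) = casimir_op (p - (2 * a)%N%:Z) (iter a F v).
Proof.
move=> pv; elim: a => [|a IH]; first by rewrite muln0 subr0.
rewrite /= IH F_casimir_op; first by congr casimir_op; lia.
exact: wt_iterF.
Qed.

Lemma casimir_FE (m j : int) (w : V) : casimir_op (m - j - j) w = casimir_scalar x m *: w ->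
  F (E w) = (qi j * qi (m - j + 1)) *: w.
Proof.
by move=> e; rewrite -casimir_sub // scalerBl -e /casimir_op addrK.
Qed.

Definition dpow (G : V -> V) (a : nat) (v : V) := (qf a)^-1 *: iter a G v.

(** The triple sum that defines the braid operator on vectors of weight [p]. *)
Definition Tsum (p : int) (v : V) :=
  \sum_(a < N) \sum_(b < N) \sum_(c < N | b%:Z - a%:Z - c%:Z == p)
     ((-1) ^+ b * x ^ (b%:Z - (a * c)%N%:Z)) *:
       dpow E a (dpow F b (dpow E c v)).

Section String.
Variables (M : nat) (u : V).
Hypothesis uM : wt M u.
Hypothesis Eu : E u = 0.

Lemma string_iter_actE (c j : nat) : iter c E (iter j F u) =
  (\prod_(i < c) (qi (j%:Z - i%:Z) * qi (M%:Z - j%:Z + i%:Z + 1)))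
    *: iter (j - c) F u.
Proof.
elim: c => [|c IH]; first by rewrite big_ord0 subn0 scale1r.
rewrite iterS IH linearZ.
have [jc|cj] := leqP j c; last first.
  rewrite big_ord_recr /= -scalerA; congr (_ *: _).
  rewrite (_ : j - c = (j - c.+1).+1)%N; last lia.
  by rewrite (string_actE _ uM Eu); congr (qi _ * qi _ *: _); lia.
rewrite (_ : j - c = 0)%N /= ?Eu ?scaler0; last lia.
have jc1 : (j < c.+1)%N by [].
by rewrite (bigD1 (Ordinal jc1)) //= subrr qint0 !mul0r scale0r.
Qed.

(** The summand of [Tsum] at [F^j u], arranged so that [a] occurs only in
    [qbin x j a] and in the falling product of length [d = j - c]: the factorials
    of [[n + a]] and [[b]], with [n = M - j], divide to that product. *)
Lemma string_term (a b c d j : nat) : (j <= M)%N ->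
  (c + d = j)%N -> (b + d = (M - j) + a)%N ->
  dpow E a (dpow F b (dpow E c (iter j F u))) =
  ((\prod_(i < c) (qi (j%:Z - i%:Z) * qi (M%:Z - j%:Z + i%:Z + 1)))
   / qf c / qf (M - j) * (qbin x j a * \prod_(i < d) qi ((M - j + a)%N%:Z - i%:Z)))
   *: iter (M - j) F u.
Proof.
move=> jM cdj bd; rewrite /dpow string_iter_actE !iter_linearZ.
rewrite -iterD (_ : b + (j - c) = M - j + a)%N; last lia.
rewrite string_iter_actE addnK !scalerA; congr (_ *: _).
move: (\prod_(i < c) _) => gam.
rewrite big_split /= (qfac_ratio _ _ (M - j) a) //.
rewrite (eq_bigr (fun i : 'I_a => qi (j%:Z - a%:Z + i%:Z + 1))); last first.
  by move=> i _; congr qi; lia.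
rewrite qbin_rev // -{2}bd qfac_ratio // bd.
have an := qfac_neq0 x0 x_tors a; have bn := qfac_neq0 x0 x_tors b.
have cn := qfac_neq0 x0 x_tors c; have mn := qfac_neq0 x0 x_tors (M - j).
by field; rewrite an bn cn mn.
Qed.

Lemma string_term0 (a b c j : nat) : (j < c)%N ->
  dpow E a (dpow F b (dpow E c (iter j F u))) = 0.
Proof.
move=> jc; rewrite /dpow string_iter_actE (bigD1 (Ordinal jc)) //= subrr qint0.
by rewrite !mul0r scale0r scaler0 iter_linear0 scaler0 iter_linear0 scaler0.
Qed.

(** For fixed [c <= j] the constraint determines [b] from [a], and the sum over
    [a] is the [j]-th q-difference of a polynomial of degree [j - c].  So only
    [c = 0] contributes, through a leading coefficient that is a product of
    nonzero factors. *)
Lemma Tsum_string (j : nat) : (j <= M)%N -> (M < N)%N ->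
  exists2 kappa, kappa != 0 &
    Tsum (M%:Z - j%:Z - j%:Z) (iter j F u) = kappa *: iter (M - j) F u.
Proof.
move=> jM MN; set n := (M - j)%N.
pose A (c : nat) := (\prod_(i < c) (qi (j%:Z - i%:Z) * qi (M%:Z - j%:Z + i%:Z + 1)))
   / qf c / qf n * ((-1) ^+ (n + (j - c)) * x ^ (n%:Z - (j%:Z - c%:Z))).
pose B := \prod_(i < j) (1 - x ^+ (2 * i.+1)).
exists (A 0 * ((qfall_poly x n j)`_j * B)).
  rewrite /A big_ord0 mul1r !mulf_neq0 ?invr_eq0 ?qfac_neq0 //.
  - by rewrite signr_eq0.
  - exact: expx_neq0.
  - exact: qfall_poly_lead.
  - by apply/prodf_neq0 => i _; rewrite subr_eq0 eq_sym x_tors.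
rewrite /Tsum.
under eq_bigr do under eq_bigr do rewrite big_mkcond /=.
under eq_bigr do rewrite exchange_big /=.
rewrite exchange_big /=.
have N0 : (0 < N)%N by apply: leq_ltn_trans MN.
(* The sum over [b] has the single term [b = n + a - (j - c)].  If this is
   negative, the falling product on the right contains [[0]]; if [a > j], both
   sides vanish with the q-binomial coefficient. *)
have inner (c : 'I_N) : (c <= j)%N -> forall a : 'I_N,
  \sum_(b < N) (if b%:Z - a%:Z - c%:Z == M%:Z - j%:Z - j%:Z then
     ((-1) ^+ b * x ^ (b%:Z - (a * c)%N%:Z)) *:
       dpow E a (dpow F b (dpow E c (iter j F u))) else 0) =
  (A c * ((-1) ^+ a * qbin x j a * x ^ (a%:Z * (1 - j%:Z)) *
     (qfall_poly x n (j - c)).[x ^+ (2 * a)])) *: iter n F u.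
  move=> cj a.
  have [ja|aj] := ltnP j a.
    rewrite qbin_gt // mulr0 !mul0r mulr0 scale0r big1 // => b _.
    case: eqP => // e; rewrite (@string_term a b c (j - c) j) //; try lia.
    by rewrite qbin_gt // mul0r mulr0 scale0r scaler0.
  (* The exponent in [qdifference] absorbs the monomial of [qfall_polyE]. *)
  have e2 : x ^ (a%:Z * (1 - j%:Z)) * (qfall_poly x n (j - c)).[x ^+ (2 * a)] =
     x ^ (a%:Z * (1 - c%:Z)) * \prod_(i < j - c) qi ((n + a)%N%:Z - i%:Z).
    rewrite qfall_polyE // mulrA -expxDr //; congr (x ^ _ * _).
    by rewrite PoszM -subzn //; ring.
  have [dn|nd] := leqP (j - c) (n + a).
    have b0N : (n + a - (j - c) < N)%N by rewrite /n in dn *; lia.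
    rewrite (bigD1 (Ordinal b0N)) //= big1 ?addr0 => [|b bn]; last first.
      case: eqP => // e; case/eqP: bn; apply/val_inj => /=.
      by rewrite /n in dn *; lia.
    rewrite ifT; last by apply/eqP; rewrite /n in dn *; lia.
    rewrite (@string_term _ _ c (j - c) j) //; try by rewrite /n in dn *; lia.
    rewrite scalerA; congr (_ *: _).
    rewrite -!mulrA e2 /A -/n.
    have -> : (-1) ^+ (n + a - (j - c)) = (-1) ^+ (n + (j - c)) * (-1) ^+ a :> L.
      by rewrite -exprD -signr_odd -[RHS]signr_odd; congr (_ ^+ nat_of_bool _); lia.
    have -> : x ^ ((n + a - (j - c))%N%:Z - (a * c)%N%:Z) =
        x ^ (n%:Z - (j%:Z - c%:Z)) * x ^ (a%:Z * (1 - c%:Z)).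
      by rewrite -expxDr //; congr (x ^ _); rewrite PoszM; lia.
    by ring.
  rewrite big1 => [|b _]; last by case: eqP => // e; rewrite /n in nd; lia.
  rewrite -!mulrA e2 (bigD1 (Ordinal nd)) //= subrr qint0.
  by rewrite !(mul0r, mulr0) scale0r.
have outer (c : 'I_N) : (c <= j)%N ->
  \sum_(a < N) \sum_(b < N) (if b%:Z - a%:Z - c%:Z == M%:Z - j%:Z - j%:Z then
     ((-1) ^+ b * x ^ (b%:Z - (a * c)%N%:Z)) *:
       dpow E a (dpow F b (dpow E c (iter j F u))) else 0) =
  (A c * ((qfall_poly x n (j - c))`_j * B)) *: iter n F u.
  move=> cj; under eq_bigr do rewrite inner //.
  rewrite -scaler_suml -mulr_sumr; congr (A c * _ *: _).
  rewrite -qdifference //; last first.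
    by apply: leq_trans (qfall_poly_size _ _ _) _; lia.
  rewrite [RHS](big_ord_widen N (fun a => (-1) ^+ a * qbin x j a *
     x ^ (a%:Z * (1 - j%:Z)) * (qfall_poly x n (j - c)).[x ^+ (2 * a)]));
    last lia.
  rewrite [RHS]big_mkcond /=. apply: eq_bigr => a _.
  by case: ltnP => // ja; rewrite qbin_gt // mulr0 !mul0r.
rewrite (bigD1 (Ordinal N0)) //= (outer (Ordinal N0)) // subn0 big1 ?addr0 //.
move=> c c0; have [jc|cj] := ltnP j c.
  rewrite big1 // => a _; rewrite big1 // => b _.
  by rewrite string_term0 // scaler0; case: ifP.
have c1 : (0 < c)%N.
  by rewrite lt0n; apply: contra_neq c0 => e; apply/val_inj.
rewrite outer // nth_default ?mul0r ?mulr0 ?scale0r //.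
by apply: leq_trans (qfall_poly_size _ _ _) _; lia.
Qed.

End String.

Lemma TsumZ p c v : Tsum p (c *: v) = c *: Tsum p v.
Proof.
rewrite /Tsum /dpow scaler_sumr; apply: eq_bigr => a _.
rewrite scaler_sumr; apply: eq_bigr => b _; rewrite scaler_sumr.
apply: eq_bigr => e _; rewrite !(iter_linearZ, scalerA).
by congr (_ *: _); ring.
Qed.

Lemma TsumD p u v : Tsum p (u + v) = Tsum p u + Tsum p v.
Proof.
rewrite /Tsum /dpow -big_split; apply: eq_bigr => a _.
rewrite -big_split; apply: eq_bigr => b _; rewrite -big_split.
by apply: eq_bigr => e _; rewrite !(iter_linearD, scalerDr).
Qed.

Lemma casimir_opZ p c v : casimir_op p (c *: v) = c *: casimir_op p v.
Proof.
by rewrite /casimir_op !linearZ /= scalerDr !scalerA [c * _]mulrC.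
Qed.

Lemma casimir_op_sum p I (r : seq I) (P : pred I) (f : I -> V) :
  casimir_op p (\sum_(i <- r | P i) f i) = \sum_(i <- r | P i) casimir_op p (f i).
Proof.
by rewrite /casimir_op big_split /= -scaler_sumr !linear_sum.
Qed.

Lemma wt_dpowE a p v : wt p v -> wt (p + (2 * a)%N%:Z) (dpow E a v).
Proof. by move=> pv; apply/wtZ/wt_iterE. Qed.

Lemma wt_dpowF a p v : wt p v -> wt (p - (2 * a)%N%:Z) (dpow F a v).
Proof. by move=> pv; apply/wtZ/wt_iterF. Qed.

Lemma dpowE_casimir_op a p v : wt p v ->
  dpow E a (casimir_op p v) = casimir_op (p + (2 * a)%N%:Z) (dpow E a v).
Proof. by move=> pv; rewrite /dpow iterE_casimir_op // casimir_opZ. Qed.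

Lemma dpowF_casimir_op a p v : wt p v ->
  dpow F a (casimir_op p v) = casimir_op (p - (2 * a)%N%:Z) (dpow F a v).
Proof. by move=> pv; rewrite /dpow iterF_casimir_op // casimir_opZ. Qed.

Lemma Tsum_casimir_op p v : wt p v -> Tsum p (casimir_op p v) = casimir_op (- p) (Tsum p v).
Proof.
move=> pv; rewrite /Tsum casimir_op_sum; apply: eq_bigr => a _.
rewrite casimir_op_sum; apply: eq_bigr => b _.
rewrite casimir_op_sum; apply: eq_bigr => c /eqP e; rewrite casimir_opZ; congr (_ *: _).
have cv := wt_dpowE c pv; have bv := wt_dpowF b cv.
by rewrite dpowE_casimir_op // dpowF_casimir_op // dpowE_casimir_op //; congr casimir_op; lia.
Qed.

(** On a Casimir eigenvector of weight [m - 2 r] with [r <= m], the vector can be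
    recovered from its image under [E^r], since all the scalars [[r] [m - r + 1]]
    by which [F E] acts on the way are nonzero. *)
Lemma iter_FE r (m : int) v : wt (m - r%:Z - r%:Z) v -> r%:Z <= m ->
  casimir_op (m - r%:Z - r%:Z) v = casimir_scalar x m *: v ->
  exists2 d, d != 0 & iter r F (iter r E v) = d *: v.
Proof.
elim: r v => [|r IH] v pv rm cv; first by exists 1; rewrite ?oner_eq0 ?scale1r.
have pE : m - r%:Z - r%:Z = m - r.+1%:Z - r.+1%:Z + 2 by lia.
have [|||d d0 e] := IH (E v).
- by rewrite pE; apply: wtE.
- by lia.
- by rewrite pE -E_casimir_op // cv linearZ.
exists (d * (qi r.+1 * qi (m - r.+1%:Z + 1))).
  by apply: mulf_neq0 => //; apply: mulf_neq0; rewrite qint_eq0 //; lia.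
rewrite iterS [iter r.+1 E v]iterSr e linearZ -scalerA; congr (_ *: _).
exact: casimir_FE.
Qed.

(** Below the end of the string, that is in weight [m - 2 j] with [j > m], the
    scalars by which [E F] acts on a Casimir eigenvector never vanish. *)
Lemma casimir_iterF t (m j : int) w : wt (m - j - j) w -> m < j -> 0 <= j ->
  casimir_op (m - j - j) w = casimir_scalar x m *: w -> w != 0 -> iter t F w != 0.
Proof.
elim: t j w => [//|t IH] j w jw mj j0 cw wn; rewrite iterSr.
have pE : m - (j + 1) - (j + 1) = m - j - j - 2 by lia.
apply: (IH (j + 1)); try lia.
- by rewrite pE; apply: wtF.
- by rewrite pE -F_casimir_op // cw linearZ.
have : E (F w) = (qi (j + 1) * qi (m - j)) *: w.
  by rewrite (EF jw) (casimir_FE cw) -scalerDl qint_string.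
apply: contra_eq_neq => ->; rewrite linear0 eq_sym scaler_eq0 (negbTE wn) orbF.
by rewrite mulf_eq0 !qint_eq0 //; lia.
Qed.

Lemma string_neq0 (M : nat) (u : V) (j : nat) : wt M u -> E u = 0 -> u != 0 ->
  (j <= M)%N -> iter j F u != 0.
Proof.
move=> uM Eu un jM; apply: contra_neq un => Fj.
have := string_iter_actE uM Eu j j; rewrite Fj iter_linear0 subnn => /esym/eqP.
rewrite scaler_eq0 => /orP[|/eqP //]; rewrite prodf_seq_eq0 => /hasP[i _].
by have := ltn_ord i; rewrite /= mulf_eq0 !qint_eq0 //; lia.
Qed.

(** With [m] the weight of [E^r v] and [C] the Casimir operator, the vector
    [C v - casimir_scalar m v] is again killed by [Tsum], and already by [E^r]; by induction it is zero, so [v] is a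
    Casimir eigenvector.  If [r <= m], it is a multiple of [F^r (E^r v)] and
    [Tsum_string] applies; if [r > m], some [E^i v] lies below the end of the
    string, against the nilpotency of [F]. *)
Lemma Tsum_eq0_iterE r p v : wt p v -> iter r E v = 0 -> Tsum p v = 0 -> v = 0.
Proof.
elim: r v => [//|r IH] v pv Er Tv.
set m := p + (2 * r)%N%:Z.
have pE : p = m - r%:Z - r%:Z by rewrite /m; lia.
have [u0|un0] := eqVneq (iter r E v) 0; first exact: IH.
have um : wt m (iter r E v) by apply: wt_iterE.
have cv : casimir_op p v = casimir_scalar x m *: v.
  apply/eqP; rewrite -subr_eq0; apply/eqP/IH.
  - by rewrite -scaleNr; apply: wtD; [apply: wt_casimir_op|apply: wtZ].
  - rewrite -scaleNr iter_linearD iter_linearZ iterE_casimir_op // -/m /casimir_op.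
    by rewrite -iterS Er linear0 add0r scaleNr subrr.
  rewrite -scaleNr TsumD TsumZ Tsum_casimir_op // Tv scaler0 addr0.
  by rewrite -[0](scale0r 0) casimir_opZ !scale0r.
have Eu : E (iter r E v) = 0 by [].
have m0 := singular_ge0 um Eu un0.
have mE : m = `|m|%N by lia.
move: (`|m|%N) mE => M mE; rewrite mE in um.
have [rM|Mr] := leqP r M.
  have [d d0 e] : exists2 d, d != 0 & iter r F (iter r E v) = d *: v.
    by apply: (@iter_FE r m); rewrite -?pE //; lia.
  have MN : (M < N)%N.
    rewrite ltnNge; apply/negP => NM.
    by have := string_neq0 um Eu un0 (leqnn M); rewrite (iter_linear_ge (FN _) NM) eqxx.
  have [kappa k0] := Tsum_string um Eu rM MN.
  rewrite -mE -pE e TsumZ Tv scaler0 => /esym/eqP; rewrite scaler_eq0 (negbTE k0).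
  by rewrite (negbTE (string_neq0 um Eu un0 _)) // leq_subr.
pose j := M.+1%:Z.
have pw : p + (2 * (r - M.+1))%N%:Z = m - j - j by rewrite /j pE mE; lia.
have : iter N F (iter (r - M.+1) E v) != 0.
  apply: (@casimir_iterF _ m j); try by rewrite /j ?mE; lia.
  - by rewrite -pw; apply: wt_iterE.
  - by rewrite -pw -iterE_casimir_op // cv iter_linearZ.
  apply: contra_neq un0 => w0; rewrite -(subnK Mr) addnC iterD w0.
  exact: iter_linear0.
by rewrite FN eqxx.
Qed.

Lemma Tsum_eq0 p v : wt p v -> Tsum p v = 0 -> v = 0.
Proof. by move=> pv; apply: Tsum_eq0_iterE pv (EN v). Qed.

End SL2.

Section TsumLemmas.
Variables (L : fieldType) (x : L).

Lemma big_ord_vanish (V : nmodType) (N N' : nat) (P : pred nat) (f : nat -> V) :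
  (N <= N')%N -> (forall i, (N <= i)%N -> f i = 0) ->
  \sum_(i < N | P i) f i = \sum_(i < N' | P i) f i.
Proof.
move=> NN f0; rewrite (big_ord_widen_cond N' P f NN) [LHS]big_mkcond.
rewrite [RHS]big_mkcond; apply: eq_bigr => i _.
by case: (P i) => //=; case: ltnP => // Ni; rewrite f0.
Qed.

Lemma dpow_natural (V W : lmodType L) (f : {linear V -> W}) (G : V -> V) (G' : W -> W)
    a v : (forall v, f (G v) = G' (f v)) ->
  f (dpow x G a v) = dpow x G' a (f v).
Proof.
by move=> h; rewrite /dpow linearZ; congr (_ *: _); elim: a => //= a <-.
Qed.

(** Needed to compare the braid operators on spaces of different dimensions, as
    the dimension bounds the range of summation. *)
Lemma Tsum_widen (V : lmodType L) (E F : {linear V -> V}) N N' p v :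
  (forall v, iter N E v = 0) -> (forall v, iter N F v = 0) -> (N <= N')%N ->
  Tsum x E F N p v = Tsum x E F N' p v.
Proof.
move=> EN FN NN.
have dE a w : (N <= a)%N -> dpow x E a w = 0.
  by move=> Na; rewrite /dpow (iter_linear_ge (EN w) Na) scaler0.
have dF a w : (N <= a)%N -> dpow x F a w = 0.
  by move=> Na; rewrite /dpow (iter_linear_ge (FN w) Na) scaler0.
have d0 (G : {linear V -> V}) a : dpow x G a 0 = 0.
  by rewrite /dpow iter_linear0 scaler0.
pose S a b c := ((-1) ^+ b * x ^ (b%:Z - (a * c)%N%:Z)) *:
       dpow x E a (dpow x F b (dpow x E c v)).
pose C a b c := b%:Z - a%:Z - c%:Z == p.
rewrite /Tsum (@big_ord_vanish _ N N' xpredT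
  (fun a => \sum_(b < N) \sum_(c < N | C a b c) S a b c)) //; last first.
  by move=> a Na; rewrite big1 // => b _; rewrite big1 // => c _;
    rewrite /S dE // scaler0.
apply: eq_bigr => a _; rewrite (@big_ord_vanish _ N N' xpredT
  (fun b => \sum_(c < N | C a b c) S a b c)) //; last first.
  by move=> b Nb; rewrite big1 // => c _; rewrite /S dF // d0 scaler0.
apply: eq_bigr => b _.
by apply: (@big_ord_vanish _ N N' (C a b) (S a b)) => // c Nc; rewrite /S (dE c) // !d0 scaler0.
Qed.

Lemma Tsum_natural (V W : lmodType L) (f : {linear V -> W})
    (E F : {linear V -> V}) (E' F' : {linear W -> W}) N p v :
  (forall v, f (E v) = E' (f v)) -> (forall v, f (F v) = F' (f v)) ->
  f (Tsum x E F N p v) = Tsum x E' F' N p (f v).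
Proof.
move=> hE hF; rewrite /Tsum linear_sum; apply: eq_bigr => a _.
rewrite linear_sum; apply: eq_bigr => b _; rewrite linear_sum.
apply: eq_bigr => c _; rewrite linearZ.
by rewrite (dpow_natural _ _ hE) (dpow_natural _ _ hF) (dpow_natural _ _ hE).
Qed.

End TsumLemmas.

(** * Linear algebra *)

Lemma invmx_eigen (L : fieldType) n (A : 'M[L]_n) (u : 'cV_n) (c : L) :
  A \in unitmx -> c != 0 -> A *m u = c *: u -> invmx A *m u = c^-1 *: u.
Proof.
move=> uA c0 e; rewrite -[u in RHS](mulKmx uA) e -scalemxAr scalerA mulVf //.
by rewrite scale1r.
Qed.

Section LinearAlgebra.
Variables (L : fieldType).

(** A subspace can thus be defined by a propositional spanning set. *)
Lemma span_pred (vT : vectType L) (Phi : vT -> Prop) :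
  exists X : seq vT, [/\ free X, {in X, forall v, Phi v} &
    forall v, Phi v -> v \in <<X>>%VS].
Proof.
pose P m := `[< exists X : seq vT, [/\ size X = m, free X & {in X, forall v, Phi v}] >].
have exP : exists m, P m.
  by exists 0%N; apply/asboolP; exists [::]; split=> //; rewrite nil_free.
have ubP m : P m -> (m <= \dim {:vT})%N.
  by case/asboolP=> X [<- /eqnP <- _]; apply/dimvS/subvf.
case: (ex_maxnP exP ubP) => m /asboolP[X [sX fX hX]] mmax; exists X; split=> // v hv.
apply: contraT => vX; have : P m.+1.
  apply/asboolP; exists (v :: X); rewrite free_cons vX fX /= sX; split=> // w.
  by rewrite inE => /orP[/eqP->|/hX].
by move/mmax; rewrite ltnn.
Qed.

Lemma span_mulmx n m (X : seq 'cV[L]_n) (A : 'M[L]_(m, n)) (U : {vspace 'cV[L]_m}) :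
  {in X, forall v, A *m v \in U} -> forall v, v \in <<X>>%VS -> A *m v \in U.
Proof.
move=> h v; rewrite -[X]in_tupleE => /coord_span ->.
rewrite mulmx_sumr memv_suml // => i _; rewrite -scalemxAr memvZ // h //.
by rewrite mem_nth.
Qed.

Lemma mulmx_ext n m (A B : 'M[L]_(m, n)) :
  (forall v : 'cV_n, A *m v = B *m v) -> A = B.
Proof.
move=> h; apply/matrixP => i j; have /matrixP/(_ i 0) := h (delta_mx j 0).
by rewrite -!colE !mxE.
Qed.

Lemma linear_mulmx n m (f : {linear 'cV[L]_n -> 'cV[L]_m}) :
  exists M : 'M[L]_(m, n), forall v, M *m v = f v.
Proof.
exists (\matrix_(i, j) f (delta_mx j 0) i 0) => v.
have {2}-> : v = \sum_j v j 0 *: delta_mx j 0.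
  apply/colP => i; rewrite summxE (bigD1 i) //= big1 => [|j ji].
    by rewrite !mxE !eqxx mulr1 addr0.
  by rewrite !mxE eq_sym (negbTE ji) mulr0.
rewrite linear_sum; apply/colP => i; rewrite !mxE summxE; apply: eq_bigr => j _.
by rewrite linearZ !mxE mulrC.
Qed.

Lemma unitmx_inj n (A : 'M[L]_n) :
  (forall v : 'cV_n, A *m v = 0 -> v = 0) -> A \in unitmx.
Proof.
move=> h; rewrite -unitmx_tr -row_free_unit -kermx_eq0 -trmx_eq0.
apply/eqP/mulmx_ext => v; rewrite mul0mx; apply: h.
by rewrite mulmxA -{1}[A]trmxK -trmx_mul mulmx_ker trmx0 mul0mx.
Qed.

Lemma mulmx_ker_vspace n m (A : 'M[L]_(m, n)) :
  exists B : {vspace 'cV[L]_n}, forall v, (v \in B) = (A *m v == 0).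
Proof. by exists (lker (linfun (mulmx A))) => v; rewrite memv_ker lfunE. Qed.

End LinearAlgebra.

Section MatrixAlgebra.
Variable L : fieldType.

Lemma tensmxZl m n p q c (A : 'M[L]_(m, n)) (B : 'M[L]_(p, q)) :
  (c *: A) *t B = c *: (A *t B).
Proof. by apply/matrixP => i j; rewrite !mxE mulrA. Qed.

Lemma tensmxZr m n p q c (A : 'M[L]_(m, n)) (B : 'M[L]_(p, q)) :
  A *t (c *: B) = c *: (A *t B).
Proof. by apply/matrixP => i j; rewrite !mxE mulrCA. Qed.

Lemma tensmx11 m n : (1%:M : 'M[L]_m) *t (1%:M : 'M[L]_n) = 1%:M.
Proof.
apply/matrixP => i j; case: (mxtens_indexP i) => a b {i}.
case: (mxtens_indexP j) => c d {j}; rewrite tensmxE !mxE -natrM mulnb.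
by rewrite (can_eq (@mxtens_indexK m n)) xpair_eqE.
Qed.

Lemma tensmx_invmx m n (A : 'M[L]_m) (B : 'M[L]_n) : A \in unitmx -> B \in unitmx ->
  (invmx A *t invmx B) *m (A *t B) = 1%:M.
Proof. by move=> uA uB; rewrite tensmx_mul !mulVmx // tensmx11. Qed.

Lemma tensmx_unitmx m n (A : 'M[L]_m) (B : 'M[L]_n) : A \in unitmx ->
  B \in unitmx -> A *t B \in unitmx.
Proof. by move=> uA uB; have [] := mulmx1_unit (tensmx_invmx uA uB). Qed.

Lemma invmx_mul n (A B : 'M[L]_n) : A \in unitmx -> B \in unitmx ->
  invmx (A *m B) = invmx B *m invmx A.
Proof.
move=> uA uB; have uAB : A *m B \in unitmx by rewrite unitmx_mul uA.
by rewrite -[RHS](mulmxK uAB) -(mulmxA (invmx B)) mulKmx // mulVmx // mul1mx.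
Qed.

Lemma invmx_comm n (A B : 'M[L]_n) : A *m B = B *m A ->
  A *m invmx B = invmx B *m A.
Proof.
move=> c; have [uB|nB] := boolP (B \in unitmx); last by rewrite invmx_out.
by rewrite -[LHS](mulKmx uB) (mulmxA B) -c -mulmxA mulmxV // mulmx1.
Qed.

Lemma invmx_intertwine n m (f : 'M[L]_(m, n)) (A : 'M[L]_n) (B : 'M[L]_m) :
  A \in unitmx -> B \in unitmx -> f *m A = B *m f -> f *m invmx A = invmx B *m f.
Proof.
by move=> uA uB c; rewrite -[LHS](mulKmx uB) (mulmxA B) -c mulmxK.
Qed.

(** With [A], [B], [C] the factors [T^-1], [J^-1], [S] of [Y^-1 (x) Y^-1], and
    [D], [G], [H] the factors [S^-1], [J], [T] of [Delta(Y)]. *)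
Lemma unitarization_algebra n (Th A B C D G H : 'M[L]_n) :
  B *m G = Th -> A *m Th = Th *m A -> C *m G = G *m C -> C *m H = H *m C ->
  D *m G = G *m D -> D *m H = H *m D ->
  Th *m (A *m H) *m (C *m D) = (A *m (B *m C)) *m (D *m (G *m H)).
Proof.
move=> BG ATh CG CH DG DH.
rewrite (mulmxA D G) DG -(mulmxA G D) DH -!mulmxA (mulmxA C G) CG -(mulmxA G C).
by rewrite (mulmxA C H) CH (mulmxA B G) BG (mulmxA A Th) ATh -!mulmxA.
Qed.

End MatrixAlgebra.

Lemma mulf_cancel3 (L : fieldType) (a b c : L) : a != 0 -> b != 0 ->
  a * b * c * (a^-1 * b^-1) = c.
Proof. by move=> a0 b0; field; rewrite a0 b0. Qed.

Lemma left_inverse_comm (L : fieldType) n (A U M : 'M[L]_n) :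
  A *m U = 1%:M -> U *m M = M *m U -> A *m M = M *m A.
Proof.
move=> AU UM; have UA := mulmx1C AU.
by rewrite -[LHS]mulmx1 -UA mulmxA -(mulmxA A) -UM mulmxA AU mul1mx.
Qed.

Lemma intertwine_mul (L : fieldType) n m (f : 'M[L]_(m, n)) (A B : 'M_n) (A' B' : 'M_m) :
  f *m A = A' *m f -> f *m B = B' *m f -> f *m (A *m B) = (A' *m B') *m f.
Proof. by move=> eA eB; rewrite mulmxA eA -mulmxA eB mulmxA. Qed.

Lemma invmx_mul3 (L : fieldType) n (A B C : 'M[L]_n) :
  A \in unitmx -> B \in unitmx -> C \in unitmx ->
  invmx (invmx A *m (B *m C)) = invmx C *m (invmx B *m A).
Proof.
move=> uA uB uC; rewrite !invmx_mul ?invmxK ?mulmxA //.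
  by rewrite unitmx_inv.
by rewrite unitmx_mul uB.
Qed.

Section TensorVectors.
Variables (L : fieldType) (n m : nat).

(** The tensor product of column vectors, retyped from width [1 * 1] to
    width [1]. *)
Definition tenscv (v : 'cV[L]_n) (w : 'cV[L]_m) : 'cV[L]_(n * m) := v *t w.

Lemma tenscv_mul (A : 'M[L]_n) (B : 'M[L]_m) v w :
  (A *t B) *m tenscv v w = tenscv (A *m v) (B *m w).
Proof. exact: (tensmx_mul A B v w). Qed.

Lemma tenscvZ a b v w : tenscv (a *: v) (b *: w) = (a * b) *: tenscv v w.
Proof. by rewrite /tenscv tensmxZl tensmxZr scalerA. Qed.

Lemma col_tensmx (A : 'M[L]_n) (B : 'M[L]_m) (j : 'I_(n * m)) :
  col j (A *t B) = tenscv (col (mxtens_unindex j).1 A) (col (mxtens_unindex j).2 B).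
Proof. by apply/colP => i; rewrite !mxE. Qed.

End TensorVectors.

(** * Weights, the invariant form and powers of q *)

Section Pairing.
Variable g : simple_datum.
Implicit Types (H : coweight g) (mu nu : hdual g).

Lemma pairingD H mu nu : pairing H (mu + nu) = pairing H mu + pairing H nu.
Proof.
by rewrite /pairing -big_split; apply: eq_bigr => j _; rewrite mxE mulrDr.
Qed.

Lemma pairingZ H c mu : pairing H (c *: mu) = c * pairing H mu.
Proof.
by rewrite /pairing mulr_sumr; apply: eq_bigr => j _; rewrite mxE mulrCA.
Qed.

Lemma pairingN H mu : pairing H (- mu) = - pairing H mu.
Proof. by rewrite -scaleN1r pairingZ mulN1r. Qed.

Lemma pairing_alpha H j : pairing H (alpha j) = (H 0 j)%:~R.
Proof.
rewrite /pairing (bigD1 j) //= big1 => [|l lj]; last first.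
  by rewrite mxE eqxx (negbTE lj) mulr0.
by rewrite mxE !eqxx mulr1 addr0.
Qed.

Lemma pairing_delta j mu : pairing (delta_mx 0 j) mu = mu 0 j.
Proof.
rewrite /pairing (bigD1 j) //= big1 => [|l lj]; last first.
  by rewrite mxE eqxx (negbTE lj) mul0r.
by rewrite mxE !eqxx mul1r addr0.
Qed.

Lemma pairing_inj mu nu : (forall H, pairing H mu = pairing H nu) -> mu = nu.
Proof. by move=> e; apply/rowP => j; rewrite -!pairing_delta e. Qed.

Lemma pairing_coroot_alpha i j :
  pairing (coroot i) (alpha j) = (cartan g i j)%:~R.
Proof. by rewrite pairing_alpha mxE. Qed.

Lemma pairingZl (d : int) H mu : pairing (d *: H) mu = d%:~R * pairing H mu.
Proof.
by rewrite /pairing mulr_sumr; apply: eq_bigr => j _; rewrite mxE intrM mulrA.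
Qed.

Lemma weightD mu nu : weight mu -> weight nu -> weight (mu + nu).
Proof. by move=> hm hn i; rewrite pairingD; apply: rpredD; [apply: hm|apply: hn]. Qed.

Lemma weightN mu : weight mu -> weight (- mu).
Proof. by move=> hm i; rewrite pairingN rpredN; apply: hm. Qed.

Lemma weight_alpha i : weight (alpha i : hdual g).
Proof. by move=> j; rewrite pairing_coroot_alpha intr_int. Qed.

Lemma srefl_inj i : injective (srefl i : hdual g -> _).
Proof.
apply: can_inj (srefl i) _ => mu.
rewrite /srefl pairingD pairingN pairingZ pairing_coroot_alpha cartan_diag.
rewrite -addrA -opprD -scalerDl -[RHS]subr0; congr (_ - _).
by rewrite [X in X *: _](_ : _ = 0) ?scale0r //; ring.
Qed.

End Pairing.

Section Qpow.
Variables (R : realType) (k : nat).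
Local Notation qp := (qpow R k).

(** The exponents for which [qpow] is an honest power; for the others the floor
    in its definition spoils multiplicativity. *)
Definition kint (z : rat) := k%:R * z \is a Num.int.

Lemma tofracX_tors n : (0 < n)%N -> tofrac ('X : {poly R[i]}) ^+ n != 1.
Proof.
move=> n0; rewrite -tofracXn -tofrac1 tofrac_eq; apply/eqP => e.
by have := size_polyXn R[i] n; rewrite e size_poly1; case: n n0 {e}.
Qed.

Lemma tofracX_neq0 : tofrac ('X : {poly R[i]}) != 0.
Proof. by rewrite tofrac_eq0 polyX_eq0. Qed.

Lemma qpow_neq0 z : qp z != 0.
Proof. exact/expfz_neq0/tofracX_neq0. Qed.

Lemma qpow0 : qp 0 = 1.
Proof. by rewrite /qpow mulr0 floor0. Qed.

Lemma qpowD y z : kint y -> kint z -> qp (y + z) = qp y * qp z.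
Proof.
rewrite /qpow /kint mulrDr => /intrP[a ->] /intrP[b ->].
by rewrite -intrD !intrKfloor expfzDr // tofracX_neq0.
Qed.

Lemma kintD y z : kint y -> kint z -> kint (y + z).
Proof. by rewrite /kint mulrDr => *; rewrite rpredD. Qed.

Lemma kintN z : kint z -> kint (- z).
Proof. by rewrite /kint mulrN => *; rewrite rpredN. Qed.

Lemma qpowN z : kint z -> qp (- z) = (qp z)^-1.
Proof.
move=> kz; apply: (mulfI (qpow_neq0 z)); rewrite -qpowD ?kintN //.
by rewrite subrr qpow0 divff // qpow_neq0.
Qed.

Lemma qpowB y z : kint y -> kint z -> qp (y - z) = qp y / qp z.
Proof. by move=> ky kz; rewrite qpowD ?kintN // qpowN. Qed.

Lemma qpow_inj y z : (0 < k)%N -> kint y -> kint z -> qp y = qp z -> y = z.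
Proof.
move=> k0 ky kz e; apply/eqP; rewrite -subr_eq0.
have : qp (y - z) = 1 by rewrite qpowB // e divff ?qpow_neq0.
have : kint (y - z) by rewrite kintD ?kintN.
rewrite /qpow /kint => /intrP[a ea]; rewrite ea intrKfloor => e1.
have : a = 0.
  case: a {ea} e1 => [[|n]//|n].
    by rewrite -exprnP => e1; have := @tofracX_tors n.+1 isT; rewrite e1 eqxx.
  rewrite NegzE -exprnN => /(congr1 GRing.inv); rewrite invrK invr1 => e1.
  by have := @tofracX_tors n.+1 isT; rewrite e1 eqxx.
move=> a0; move/eqP: ea; rewrite a0 mulf_eq0 => /orP[|//].
by rewrite pnatr_eq0; case: k k0.
Qed.

Lemma qpow_tors (d n : nat) : (0 < k)%N -> (0 < d)%N -> (0 < n)%N ->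
  qp d%:R ^+ n != 1.
Proof.
move=> k0 d0 n0; rewrite /qpow -natrM -[X in Num.floor X]/((k * d)%N%:Z%:~R).
by rewrite intrKfloor -exprnP -exprM tofracX_tors // !muln_gt0 k0 d0.
Qed.

Lemma qpow_exp (d : nat) (z : int) : qp d%:R ^ z = qp (d%:R * z%:~R).
Proof.
rewrite /qpow mulrA -natrM -[X in Num.floor X ]/((k * d)%N%:Z%:~R) intrKfloor.
rewrite -[X in _ = _ ^ Num.floor (X * _)]/((k * d)%N%:Z%:~R) -intrM intrKfloor.
by rewrite exprz_exp.
Qed.

End Qpow.

(** * Weight modules *)

Section WeightModules.
Variables (R : realType) (g : simple_datum) (k : nat).
Hypothesis hk : sufficiently_divisible g k.
Local Notation K := (Kq R).
Local Notation qp := (qpow R k).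

Lemma kgt0 : (0 < k)%N. Proof. by case: hk. Qed.

Lemma kint_pairing (H : coweight g) mu : weight mu -> kint k (pairing H mu).
Proof. by case: hk => _ h _; apply: h. Qed.

Lemma kint_alpha (H : coweight g) j : kint k (pairing H (alpha j)).
Proof. exact/kint_pairing/weight_alpha. Qed.

Section OneModule.
Variables (n : nat) (V : action R g n).
Implicit Types (v : 'cV[K]_n) (mu nu : hdual g).
Local Notation wv := (weight_vector k V).

(** What the construction of [T_i] and [J] uses of a representation, in a form
    that passes to tensor products. *)
Record weight_shift := WeightShift {
  ws_KE : forall H j, actK V H *m actE V j
    = qp (pairing H (alpha j)) *: (actE V j *m actK V H);
  ws_KF : forall H j, actK V H *m actF V j
    = qp (- pairing H (alpha j)) *: (actF V j *m actK V H) }.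

Record weight_module := WeightModule {
  wm_shift :> weight_shift;
  wm_span : exists (P : 'M[K]_n) (wts : 'I_n -> hdual g),
    P \in unitmx /\ forall j, wv (wts j) (col j P) }.

Lemma weight_vector0 mu : weight mu -> wv mu 0.
Proof. by move=> wm; split=> // H; rewrite mulmx0 scaler0. Qed.

Lemma weight_vectorD mu u v : wv mu u -> wv mu v -> wv mu (u + v).
Proof. by case=> wm hu [_ hv]; split=> // H; rewrite mulmxDr hu hv scalerDr. Qed.

Lemma weight_vectorZ mu c v : wv mu v -> wv mu (c *: v).
Proof.
by case=> wm hv; split=> // H; rewrite -scalemxAr hv !scalerA mulrC.
Qed.

Lemma weight_vector_sum mu I (r : seq I) (P : pred I) (f : I -> 'cV[K]_n) : weight mu ->
  (forall i, P i -> wv mu (f i)) -> wv mu (\sum_(i <- r | P i) f i).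
Proof.
move=> wm h; elim/big_rec: _ => [|i v Pi]; first exact: weight_vector0.
exact/weight_vectorD/h.
Qed.

Section Shift.
Hypothesis ws : weight_shift.

Lemma weight_vector_actE mu v j : wv mu v -> wv (mu + alpha j) (actE V j *m v).
Proof.
case=> wmu hv; split=> [|H]; first exact/weightD/weight_alpha.
rewrite mulmxA (ws_KE ws) -scalemxAl -mulmxA hv -scalemxAr scalerA.
rewrite -qpowD ?pairingD 1?addrC //; first exact: kint_alpha.
exact: kint_pairing.
Qed.

Lemma weight_vector_actF mu v j : wv mu v -> wv (mu - alpha j) (actF V j *m v).
Proof.
case=> wmu hv; split=> [|H]; first exact/weightD/weightN/weight_alpha.
rewrite mulmxA (ws_KF ws) -scalemxAl -mulmxA hv -scalemxAr scalerA.
rewrite -qpowD ?pairingD ?pairingN 1?addrC //; first exact/kintN/kint_alpha.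
exact: kint_pairing.
Qed.

Lemma weight_vector_iterE mu v j a : wv mu v ->
  wv (mu + alpha j *+ a) (iter a (mulmx (actE V j)) v).
Proof.
move=> h; elim: a => [|a IH]; first by rewrite addr0.
by rewrite iterS mulrSr addrA; apply: weight_vector_actE.
Qed.

Lemma weight_vector_iterF mu v j a : wv mu v ->
  wv (mu - alpha j *+ a) (iter a (mulmx (actF V j)) v).
Proof.
move=> h; elim: a => [|a IH]; first by rewrite subr0.
by rewrite iterS mulrSr opprD addrA; apply: weight_vector_actF.
Qed.

End Shift.

Hypothesis wm : weight_module.

(** A weight vector has coordinates only along the basis vectors of its own
    weight. *)
Lemma weight_vector_coord (P : 'M[K]_n) (wts : 'I_n -> hdual g) mu v j :
  P \in unitmx -> (forall j, wv (wts j) (col j P)) -> wv mu v ->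
  (invmx P *m v) j 0 != 0 -> wts j = mu.
Proof.
move=> uP hP [wmu hv] cj; apply: pairing_inj => H.
apply: (@qpow_inj R k); rewrite ?kgt0 //; try exact: kint_pairing.
  by apply: kint_pairing; case: (hP j).
set c := invmx P *m v in cj *.
have KP : actK V H *m P = P *m diag_mx (\row_i qp (pairing H (wts i))).
  apply/matrixP => a b; rewrite mul_mx_diag.
  have [_ /(_ H) /matrixP/(_ a 0)] := hP b; rewrite !mxE => e.
  rewrite -[RHS]mulrC -e; apply: eq_bigr => l _; by rewrite !mxE.
have vE : v = P *m c by rewrite /c (mulKVmx uP).
clearbody c.
have : P *m (diag_mx (\row_i qp (pairing H (wts i))) *m c)
     = P *m (qp (pairing H mu) *: c).
  by rewrite mulmxA -KP -mulmxA -vE hv vE scalemxAr.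
move/(congr1 (mulmx (invmx P))); rewrite !(mulKmx uP) => /matrixP/(_ j 0).
by rewrite mul_diag_mx !mxE => /(mulIf cj).
Qed.

Lemma weight_module_ext m (A B : 'M[K]_(m, n)) :
  (forall mu v, wv mu v -> A *m v = B *m v) -> A = B.
Proof.
move=> h; have [P [wts [uP hP]]] := wm_span wm.
rewrite -(mulmxK uP A) -(mulmxK uP B); congr (_ *m _).
apply/matrixP => a b; have /matrixP/(_ a 0) := h _ _ (hP b).
by rewrite !colE !mulmxA -!colE [LHS]mxE [RHS]mxE.
Qed.

(** A family of linear maps on the weight spaces extends uniquely to an operator,
    which can be written down in a basis of weight vectors. *)
Lemma weight_opP (f : hdual g -> 'cV[K]_n -> 'cV[K]_n) :
  (forall mu c u v, f mu (c *: u + v) = c *: f mu u + f mu v) ->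
  forall mu v, wv mu v -> weight_op k V f *m v = f mu v.
Proof.
move=> flin.
have f0 mu : f mu 0 = 0.
  by have := flin mu (-1) 0 0; rewrite scaler0 addr0 scaleN1r addNr.
have fZ mu c v : f mu (c *: v) = c *: f mu v.
  by have := flin mu c v 0; rewrite !addr0 f0 addr0.
suff [M hM] : exists M : 'M[K]_n, forall mu v, wv mu v -> M *m v = f mu v.
  by have := xgetPex 0 (ex_intro _ M hM :
    exists M, [set M : 'M[K]_n | forall mu v, wv mu v -> M *m v = f mu v]%classic M).
have [P [wts [uP hP]]] := wm_span wm.
exists ((\matrix_(i, j) f (wts j) (col j P) i 0) *m invmx P) => mu v hv.
rewrite -mulmxA; set c := invmx P *m v.
have vE : v = \sum_j c j 0 *: col j P.
  rewrite -[LHS](mulKVmx uP) -/c; apply/colP => i; rewrite !mxE summxE.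
  by apply: eq_bigr => j _; rewrite !mxE mulrC.
have -> : (\matrix_(i, j) f (wts j) (col j P) i 0) *m c =
   \sum_j c j 0 *: f (wts j) (col j P).
  apply/colP => i; rewrite !mxE summxE.
  by apply: eq_bigr => j _; rewrite !mxE mulrC.
rewrite [in RHS]vE.
have -> : f mu (\sum_j c j 0 *: col j P) = \sum_j c j 0 *: f mu (col j P).
  elim/big_rec2: _ => [|j y z _ <-]; first exact: f0.
  by rewrite flin.
apply: eq_bigr => j _; have [->|cj] := eqVneq (c j 0) 0; first by rewrite !scale0r.
by rewrite (weight_vector_coord uP hP hv cj).
Qed.

Lemma weight_in_basis (P : 'M[K]_n) (wts : 'I_n -> hdual g) mu v :
  P \in unitmx -> (forall j, wv (wts j) (col j P)) -> wv mu v -> v != 0 ->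
  exists j, wts j = mu.
Proof.
move=> uP hP hv v0.
have [c0|] := eqVneq (invmx P *m v) 0.
  by rewrite -(mulKVmx uP v) c0 mulmx0 eqxx in v0.
case/matrix0Pn => j [z]; rewrite ord1 => cj; exists j; exact: weight_vector_coord cj.
Qed.

(** The iterates of a weight vector under a root vector have distinct weights,
    so at most [n] of them are nonzero. *)
Lemma iter_shift_nilpotent (A : 'M[K]_n) (beta : hdual g) : beta != 0 ->
  (forall mu v, wv mu v -> wv (mu + beta) (A *m v)) ->
  forall v, iter n (mulmx A) v = 0.
Proof.
move=> b0 hA.
have hA' a mu v : wv mu v -> wv (mu + beta *+ a) (iter a (mulmx A) v).
  move=> h; elim: a => [|a IH]; first by rewrite addr0.
  by rewrite iterS mulrSr addrA; apply: hA.
have iterM a (v : 'cV[K]_n) : iter a (mulmx A) v = A ^+ a *m v.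
  by elim: a => [|a IH]; rewrite ?expr0 ?mul1mx // iterS IH exprS mulmxA.
move=> v; rewrite iterM (_ : A ^+ n = 0) ?mul0mx //; apply: weight_module_ext => mu {}v hv.
rewrite mul0mx -iterM; apply: contraTeq isT => vn0.
have [P [wts [uP hP]]] := wm_span wm.
have /choice[h hP'] : forall a : 'I_n.+1, exists j, wts j = mu + beta *+ a.
  move=> a; apply: weight_in_basis uP hP (hA' a _ _ hv) _.
  apply: contra_neq vn0 => e; have an : (a <= n)%N by rewrite -ltnS.
  exact: (@iter_linear_ge _ _ (mulmx A) a).
have : injective h.
  move=> a b hab; have := hP' a; rewrite hab hP' => /addrI/eqP.
  rewrite -!scaler_nat -subr_eq0 -scalerBl scaler_eq0 (negbTE b0) orbF subr_eq0.
  by rewrite eqr_nat => /eqP/val_inj.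
by move/leq_card; rewrite !card_ord ltnn.
Qed.

Lemma alpha_neq0 j : alpha j != 0 :> hdual g.
Proof. by apply/eqP => /rowP/(_ j)/eqP; rewrite !mxE !eqxx oner_eq0. Qed.

Lemma iterE_nilpotent j v : iter n (mulmx (actE V j)) v = 0.
Proof.
by apply: iter_shift_nilpotent (alpha_neq0 j) _ v => mu v; apply: (weight_vector_actE wm).
Qed.

Lemma iterF_nilpotent j v : iter n (mulmx (actF V j)) v = 0.
Proof.
have a0 : - alpha j != 0 :> hdual g by rewrite oppr_eq0 alpha_neq0.
by apply: iter_shift_nilpotent a0 _ v => mu v; apply: (weight_vector_actF wm).
Qed.

Definition wproj (mu : hdual g) : 'M[K]_n :=
  weight_op k V (fun nu v => if nu == mu then v else 0).

Lemma wprojE mu nu v : wv nu v -> wproj mu *m v = if nu == mu then v else 0.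
Proof.
move=> hv; rewrite (weight_opP _ hv) // => {hv}mu' c u w.
by case: eqP; rewrite ?scaler0 ?addr0.
Qed.

Lemma weight_vector_wproj mu v : weight mu -> wv mu (wproj mu *m v).
Proof.
move=> wmu; split=> // H; rewrite mulmxA scalemxAl; congr (_ *m _).
apply: weight_module_ext => nu w hw; rewrite -mulmxA -scalemxAl (wprojE _ hw).
by case: eqP => [e|_]; rewrite ?mulmx0 ?scaler0 //; case: hw => _ ->; rewrite e.
Qed.

(** The weight projections of a vector add up to the vector. *)
Lemma wproj_eq0 v : (forall mu, weight mu -> wproj mu *m v = 0) -> v = 0.
Proof.
move=> h; have [P [wts [uP hP]]] := wm_span wm.
suff -> : v = \sum_(mu <- undup (codom wts)) wproj mu *m v.
  rewrite big_seq big1 // => mu; rewrite mem_undup => /codomP[j ->].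
  by apply: h; case: (hP j).
rewrite -mulmx_suml -[LHS]mul1mx; congr (_ *m _); apply: weight_module_ext => mu w hw.
rewrite mul1mx mulmx_suml; have [->|w0] := eqVneq w 0.
  by rewrite big1 // => nu _; rewrite mulmx0.
have [j e] := weight_in_basis uP hP hw w0.
have hmu : mu \in undup (codom wts) by rewrite mem_undup -e codom_f.
rewrite (bigD1_seq mu) ?undup_uniq //= (wprojE _ hw) eqxx big1 ?addr0 // => nu.
by rewrite (wprojE _ hw) eq_sym => /negbTE->.
Qed.

End OneModule.
End WeightModules.

(** * The braid operators *)

Section BraidOperators.
Variables (R : realType) (g : simple_datum) (k : nat).
Hypothesis hk : sufficiently_divisible g k.
Local Notation K := (Kq R).
Local Notation qp := (qpow R k).
Local Notation x := (qd R k).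

Lemma qd_neq0 (i : 'I_(rank g)) : x i != 0.
Proof. exact: qpow_neq0. Qed.

Lemma qd_tors (i : 'I_(rank g)) n : (0 < n)%N -> x i ^+ n != 1.
Proof. by apply: qpow_tors; [exact: kgt0 hk|exact: dlen_gt0]. Qed.

Lemma qfactE (y : K) n : qfact y n = qfac y n.
Proof. by rewrite /qfact /qfac; apply: eq_bigr => m _; rewrite /qnum exprnN. Qed.

Lemma mulmx_expE n (A : 'M[K]_n) a (v : 'cV_n) : A ^+ a *m v = iter a (mulmx A) v.
Proof.
by elim: a => [|a IH]; rewrite ?expr0 ?mul1mx // iterS -IH exprS mulmxA.
Qed.

Lemma divE_dpow n (V : action R g n) i a (v : 'cV_n) :
  divE k V i a *m v = dpow (x i) (mulmx (actE V i)) a v.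
Proof. by rewrite /divE -scalemxAl mulmx_expE qfactE. Qed.

Lemma divF_dpow n (V : action R g n) i a (v : 'cV_n) :
  divF k V i a *m v = dpow (x i) (mulmx (actF V i)) a v.
Proof. by rewrite /divF -scalemxAl mulmx_expE qfactE. Qed.

Section OneModule.
Variables (n : nat) (V : action R g n).
Local Notation wv := (weight_vector k V).
Hypothesis wm : weight_module k V.

Lemma T_Tsum i mu v (p : int) : wv mu v -> pairing (coroot i) mu = p%:~R ->
  T k i V *m v = Tsum (x i) (mulmx (actE V i)) (mulmx (actF V i)) n p v.
Proof.
move=> hv hp; rewrite /T (weight_opP hk wm _ hv) => [|{hp hv}mu c u w].
  rewrite /Tsum; apply: eq_bigr => a _; apply: eq_bigr => b _.
  apply: eq_big => [c|c _]; first by rewrite hp eqr_int.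
  by rewrite divE_dpow divF_dpow divE_dpow.
rewrite scaler_sumr -big_split; apply: eq_bigr => a _.
rewrite scaler_sumr -big_split; apply: eq_bigr => b _.
rewrite scaler_sumr -big_split; apply: eq_bigr => d _ /=.
by rewrite !(mulmxDr, scalerDr) -!scalemxAr !scalerA mulrC.
Qed.

(** Every term of [T_i v] has weight [mu + (a - b + c) alpha_i], which is
    [s_i mu]. *)
Lemma weight_vector_T i mu v : wv mu v -> wv (srefl i mu) (T k i V *m v).
Proof.
move=> hv; have wmu : weight mu by case: hv.
have /intrP[p hp] := wmu i; rewrite (T_Tsum hv hp) /Tsum.
have ws : weight (srefl i mu).
  move=> j; rewrite /srefl hp pairingD pairingN pairingZ pairing_coroot_alpha.
  by apply: rpredB; [exact: wmu|rewrite -intrM intr_int].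
apply: weight_vector_sum => // a _; apply: weight_vector_sum => // b _; apply: weight_vector_sum => // c e.
apply: weight_vectorZ; have := hv; move/(weight_vector_iterE hk wm i c)/(@weight_vectorZ _ _ _ _ _ _ (qfac (x i) c)^-1).
move/(weight_vector_iterF hk wm i b)/(@weight_vectorZ _ _ _ _ _ _ (qfac (x i) b)^-1).
move/(weight_vector_iterE hk wm i a)/(@weight_vectorZ _ _ _ _ _ _ (qfac (x i) a)^-1).
congr (weight_vector k V _ _).
rewrite /srefl hp -(eqP e) -!scaler_nat -addrA -addrA; congr (_ + _).
rewrite -!scaleNr -!scalerDl; congr (_ *: _).
by rewrite !intrB; ring.
Qed.

End OneModule.

(** The sums on the two sides have different ranges, bounded by the two
    dimensions; both are extended to [n + m]. *)
Lemma T_intertwine n m (V : action R g n) (W : action R g m) (f : 'M[K]_(m, n)) i :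
  weight_module k V -> weight_module k W -> intertwiner V W f ->
  f *m T k i V = T k i W *m f.
Proof.
move=> wV wW [fE fF fK]; apply: (weight_module_ext wV) => mu v hv.
have [wmu hK] := hv; have /intrP[p hp] := wmu i.
have hfv : weight_vector k W mu (f *m v).
  by split=> // H; rewrite mulmxA -fK -mulmxA hK scalemxAr.
rewrite -!mulmxA (T_Tsum wV hv hp) (T_Tsum wW hfv hp).
rewrite (Tsum_widen _ _ _ (iterE_nilpotent hk wV i) (iterF_nilpotent hk wV i) (leq_addr m n)).
rewrite (Tsum_widen _ _ _ (iterE_nilpotent hk wW i) (iterF_nilpotent hk wW i) (leq_addl n m)).
by apply: (@Tsum_natural _ _ _ _ (mulmx f)) => w; rewrite /= !mulmxA ?fE ?fF.
Qed.

Section Rep.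
Variables (n : nat) (V : action R g n).
Hypothesis rV : is_rep k V.

Lemma rep_K_unit H : actK V H \in unitmx.
Proof.
have e := rep_KD rV H (- H); rewrite subrr (rep_K0 rV) in e.
by have [uK _] := mulmx1_unit e.
Qed.

Lemma rep_shift : weight_shift k V.
Proof.
split=> H j.
- by rewrite scalemxAl -(rep_KE rV) (mulmxKV (rep_K_unit H)).
- by rewrite scalemxAl -(rep_KF rV) (mulmxKV (rep_K_unit H)).
Qed.

Hypothesis wm : weight_module k V.

Lemma actKi_weight_vector i mu v (p : int) : weight_vector k V mu v ->
  pairing (coroot i) mu = p%:~R -> actKi V i *m v = x i ^ p *: v.
Proof.
by move=> [_ hv] hp; rewrite /actKi hv pairingZl hp qpow_exp.
Qed.

(** [T_i] permutes the weight spaces injectively, so its kernel is graded, and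
    [Tsum_eq0] applies to each weight component. *)
Lemma T_inj i (v : 'cV[K]_n) : T k i V *m v = 0 -> v = 0.
Proof.
move=> Tv; apply: (wproj_eq0 hk wm) => mu wmu; set w := wproj k V mu *m v.
have hw : weight_vector k V mu w by apply: weight_vector_wproj.
have Tw : T k i V *m w = 0.
  have e : T k i V *m wproj k V mu = wproj k V (srefl i mu) *m T k i V.
    apply: (weight_module_ext wm) => nu u hu; rewrite -!mulmxA (wprojE hk wm _ hu).
    rewrite (wprojE hk wm _ (weight_vector_T wm i hu)) (inj_eq (@srefl_inj _ i)).
    by case: ifP; rewrite ?mulmx0.
  by rewrite /w mulmxA e -mulmxA Tv mulmx0.
have /intrP[p hp] := wmu i.
have xi0 := qd_neq0 i.
have hKE : actKi V i *m actE V i = x i ^+ 2 *: (actE V i *m actKi V i).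
  rewrite /actKi (ws_KE wm) pairingZl pairing_coroot_alpha cartan_diag.
  by rewrite -[(dlen i)%:Z%:~R]/((dlen i)%:R) -qpow_exp.
have hKF : actKi V i *m actF V i = x i ^- 2 *: (actF V i *m actKi V i).
  rewrite /actKi (ws_KF wm) pairingZl pairing_coroot_alpha cartan_diag.
  by rewrite -mulrN -[(dlen i)%:Z%:~R]/((dlen i)%:R) -intrN -qpow_exp exprnN.
apply: (@Tsum_eq0 K (x i) (qd_neq0 i) (@qd_tors i) _ (mulmx (actE V i))
  (mulmx (actF V i)) (fun p v => actKi V i *m v = x i ^ p *: v) n _ _ _ _ _ _ _ p).
- by move=> q u u' e e'; rewrite mulmxDr e e' scalerDr.
- by move=> q c u e; rewrite -scalemxAr e !scalerA mulrC.
- move=> q u e /=; rewrite mulmxA hKE -scalemxAl -mulmxA e -scalemxAr scalerA.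
  by rewrite addrC expfzDr.
- move=> q u e /=; rewrite mulmxA hKF -scalemxAl -mulmxA e -scalemxAr scalerA.
  by rewrite addrC expfzDr // exprnN.
- move=> q u e /=; apply/eqP; rewrite addrC -subr_eq !mulmxA -mulmxBl.
  rewrite (rep_EF rV) eqxx -scalemxAl mulmxBl e.
  have uK : actKi V i \in unitmx by apply: rep_K_unit.
  rewrite (invmx_eigen uK (expfz_neq0 q xi0) e).
  by rewrite -scalerBl scalerA qintE; apply/eqP; congr (_ *: _); apply: mulrC.
- exact: (iterE_nilpotent hk wm i).
- exact: (iterF_nilpotent hk wm i).
- exact: (actKi_weight_vector hw hp).
- by rewrite -(T_Tsum wm hw hp).
Qed.

End Rep.
End BraidOperators.

(** * Singular vectors and complete reducibility *)

Section Representations.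
Variables (R : realType) (g : simple_datum) (k : nat).
Hypothesis hk : sufficiently_divisible g k.
Local Notation K := (Kq R).
Local Notation qp := (qpow R k).

(** Possibly zero, so that the image of a singular vector under an intertwiner is
    again singular. *)
Definition singular n (V : action R g n) lambda (v : 'cV[K]_n) :=
  weight_vector k V lambda v /\ forall i, actE V i *m v = 0.

Lemma intertwiner_comp n m l (U : action R g n) (V : action R g m)
    (W : action R g l) (f : 'M[K]_(m, n)) (h : 'M[K]_(l, m)) :
  intertwiner U V f -> intertwiner V W h -> intertwiner U W (h *m f).
Proof.
case=> fE fF fK [hE hF hK]; split=> i.
- by rewrite -mulmxA fE mulmxA hE mulmxA.
- by rewrite -mulmxA fF mulmxA hF mulmxA.
- by rewrite -mulmxA fK mulmxA hK mulmxA.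
Qed.

Lemma intertwiner1 n (V : action R g n) : intertwiner V V 1%:M.
Proof. by split=> i; rewrite mulmx1 mul1mx. Qed.

Lemma intertwiner_singular n m (V : action R g n) (W : action R g m) f lambda v :
  intertwiner V W f -> singular V lambda v -> singular W lambda (f *m v).
Proof.
case=> fE _ fK [[wl hv] Ev]; split; first split=> // H.
- by rewrite mulmxA -fK -mulmxA hv scalemxAr.
- by move=> i; rewrite mulmxA -fE -mulmxA Ev mulmx0.
Qed.

Section OneRep.
Variables (n : nat) (V : action R g n).
Implicit Types (v : 'cV[K]_n) (S : {vspace 'cV[K]_n}).
Local Notation wv := (weight_vector k V).

Lemma stable_capv S S' : stable V S -> stable V S' -> stable V (S :&: S')%VS.
Proof.
move=> hS hS' v; rewrite memv_cap => /andP[/hS[e f h] /hS'[e' f' h']].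
by split=> i; rewrite memv_cap ?e ?e' ?f ?f' ?h ?h'.
Qed.

Lemma irreducible_sub lambda S B v : irreducible_hw k V lambda S -> stable V B ->
  v \in S -> v \in B -> v != 0 -> (S <= B)%VS.
Proof.
case=> _ hS hirr _ hB vS vB v0.
have [e|e] := hirr _ (stable_capv hS hB) (capvSl _ _); last first.
  by apply/capv_idPl.
have : v \in (S :&: B)%VS by rewrite memv_cap vS vB.
by rewrite e memv0 (negbTE v0).
Qed.

(** An irreducible summand that meets [B] in its highest weight vector lies
    in [B]. *)
Lemma fdrep_stable_full B : fdrep k V -> stable V B ->
  (forall lambda v, dominant lambda -> singular V lambda v -> v \in B) ->
  forall v, v \in B.
Proof.
move=> [_ [m [lam [S [hS _ sumS]]]]] hB hsing v.
suff : (fullv <= B)%VS by move/subvP; apply; rewrite memvf.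
rewrite -sumS; apply/subv_sumP => j _.
have [dl hSj hirr [w [wS w0 hw Ew]]] := hS j.
apply: irreducible_sub (hS j) hB wS _ w0; exact: hsing dl _.
Qed.

(** The vectors on which two intertwiners agree form a subrepresentation. *)
Lemma fdrep_ext m (W : action R g m) (A B : 'M[K]_(m, n)) : fdrep k V ->
  intertwiner V W A -> intertwiner V W B ->
  (forall lambda v, singular V lambda v -> A *m v = B *m v) -> A = B.
Proof.
move=> fV [aE aF aK] [bE bF bK] h.
have [U hU] := mulmx_ker_vspace (A - B).
apply: mulmx_ext => v; apply/eqP; rewrite -subr_eq0 -mulmxBl -hU.
apply: fdrep_stable_full => // [u|lambda u _ /h e]; last first.
  by rewrite hU mulmxBl e subrr.
rewrite hU => /eqP e; split=> i; rewrite hU mulmxA mulmxBl.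
- by rewrite aE bE -mulmxBr -mulmxA e mulmx0.
- by rewrite aF bF -mulmxBr -mulmxA e mulmx0.
- by rewrite aK bK -mulmxBr -mulmxA e mulmx0.
Qed.

Lemma fdrep_rep : fdrep k V -> is_rep k V. Proof. by case. Qed.

(** The weight vectors span a subrepresentation, and it contains the singular
    vectors. *)
Lemma fdrep_weight_module : fdrep k V -> weight_module k V.
Proof.
move=> fV; have ws := rep_shift (fdrep_rep fV).
have [X [fX hX XP]] := span_pred (fun v => exists mu, wv mu v).
have full v : v \in <<X>>%VS.
  apply: fdrep_stable_full => // [{}v vX|lambda w _ [hw _]]; last by apply: XP; exists lambda.
  split=> i; apply: span_mulmx vX => w /hX[mu hw]; apply: XP.
  - by exists (mu + alpha i); apply: weight_vector_actE.
  - by exists (mu - alpha i); apply: weight_vector_actF.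
  - by exists mu; case: (hw) => _ ->; apply: weight_vectorZ.
have sX : size X = n.
  have dX : \dim <<X>> = size X by apply/eqnP.
  have eX : <<X>>%VS = fullv by apply/vspaceP => v; rewrite full memvf.
  by rewrite -dX eX dimvf dim_matrix mulr1.
have hX' (j : 'I_n) : {mu | wv mu X`_j}.
  by apply: cid; apply: hX; rewrite mem_nth // sX.
split=> //; exists (\matrix_(i, j) X`_j i 0), (fun j => sval (hX' j)).
split=> [|j]; last first.
  have -> : col j (\matrix_(i, j) X`_j i 0) = X`_j by apply/colP => i; rewrite !mxE.
  exact: (svalP (hX' j)).
apply: unitmx_inj => c Xc.
have sXb : size X == n by rewrite sX.
have /freeP fr : free (Tuple sXb) by [].
apply/colP => j; rewrite mxE; apply: (fr (fun j => c j 0)).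
rewrite -[RHS]Xc; apply/colP => i; rewrite !mxE summxE.
by apply: eq_bigr => l _; rewrite !mxE mulrC.
Qed.

End OneRep.
End Representations.

(** * Operators that are scalar on irreducible components *)

Section Central.
Variables (R : realType) (g : simple_datum) (k : nat).
Hypothesis hk : sufficiently_divisible g k.
Local Notation K := (Kq R).

(** Each [F_i] lowers the height by one, so it bounds the length of words
    in the [F_i]. *)
Definition height (mu : hdual g) : rat := \sum_j mu 0 j.

Lemma height_sub_roots (mu : hdual g) (s : seq 'I_(rank g)) :
  height (mu - \sum_(i <- s) alpha i) = height mu - (size s)%:R.
Proof.
rewrite /height (eq_bigr (fun j => mu 0 j - (\sum_(i <- s) alpha i) 0 j)); last first.
  by move=> j _; rewrite !mxE.
rewrite sumrB; congr (_ - _); elim: s => [|i s IH].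
  by rewrite big_nil big1 // => j _; rewrite mxE.
rewrite big_cons (eq_bigr (fun j => (alpha i) 0 j + (\sum_(i <- s) alpha i) 0 j)); last first.
  by move=> j _; rewrite mxE.
rewrite big_split /= IH -[in RHS]add1n natrD; congr (_ + _).
rewrite (bigD1 i) //= big1 => [|j ji]; first by rewrite mxE !eqxx addr0.
by rewrite mxE eqxx (negbTE ji).
Qed.

Section OneRep.
Variables (n : nat) (V : action R g n).
Local Notation wv := (weight_vector k V).
Hypothesis fV : fdrep k V.

Let wm : weight_module k V := fdrep_weight_module hk fV.

(** An irreducible module is spanned by the images of a singular vector under
    the words in the [F_i]; hence all its weights lie below the highest one. *)
Lemma irreducible_weights lambda S v mu w : irreducible_hw k V lambda S ->
  v \in S -> v != 0 -> forall lam, singular k V lam v ->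
  w \in S -> w != 0 -> wv mu w ->
  exists s : seq 'I_(rank g), mu = lam - \sum_(i <- s) alpha i.
Proof.
move=> hS vS v0 lam [hv Ev] wS w0 hw.
pose word s := foldr (fun i u => actF V i *m u) v s.
have hword s : wv (lam - \sum_(i <- s) alpha i) (word s).
  elim: s => [|i s IH]; first by rewrite big_nil subr0.
  by rewrite big_cons [alpha i + _]addrC opprD addrA; apply: (weight_vector_actF hk wm).
have [X [_ hX XP]] := span_pred (fun u => exists s, u = word s).
have FX i u : u \in <<X>>%VS -> actF V i *m u \in <<X>>%VS.
  by apply: span_mulmx => {}u /hX[s ->]; apply: XP; exists (i :: s).
have EX i s : actE V i *m word s \in <<X>>%VS.
  elim: s => [|j s IH]; first by rewrite Ev mem0v.
  have := rep_EF (fdrep_rep fV) i j => /(congr1 (mulmx^~ (word s))).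
  rewrite mulmxBl -!mulmxA -[actF V j *m word s]/(word (j :: s)) => /eqP.
  rewrite subr_eq => /eqP ->; apply: memvD; last exact: FX.
  case: eqP => _; last by rewrite mul0mx mem0v.
  rewrite -scalemxAl; apply: memvZ; rewrite mulmxBl.
  have [_ hK] := hword s; have ws : word s \in <<X>>%VS by apply: XP; exists s.
  have uK := rep_K_unit (fdrep_rep fV) ((dlen i)%:Z *: coroot i).
  apply: memvB; first by rewrite /actKi hK memvZ.
  by rewrite (invmx_eigen uK (qpow_neq0 _ _ _) (hK _)) memvZ.
have sX : stable V <<X>>%VS.
  move=> u uX; split=> i; first by apply: span_mulmx uX => ? /hX[s ->].
    exact: FX.
  apply: span_mulmx uX => ? /hX[s ->]; have [_ ->] := hword s.
  by apply/memvZ/XP; exists s.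
have vX : v \in <<X>>%VS by apply: XP; exists [::].
have /subvP SX := irreducible_sub hS sX vS vX v0.
apply: contrapT => no; move/eqP: w0; apply.
have : wproj k V mu *m w \in (0%VS : {vspace 'cV[K]_n}).
  apply: span_mulmx (SX _ wS) => ? /hX[s ->].
  rewrite (wprojE hk wm _ (hword s)) ifF ?mem0v //.
  by apply/eqP => e; apply: no; exists s.
by rewrite (wprojE hk wm _ hw) eqxx memv0 => /eqP.
Qed.

(** The two weights each lie below the other, so the two words of [F_i] have
    length zero. *)
Lemma irreducible_singular lambda S w mu : irreducible_hw k V lambda S ->
  w \in S -> w != 0 -> singular k V mu w -> mu = lambda.
Proof.
move=> hS wS w0 sw; have [_ _ _ [v [vS v0 hv Ev]]] := hS.
have [s es] := irreducible_weights hS vS v0 (conj hv Ev) wS w0 (proj1 sw).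
have [t et] := irreducible_weights hS wS w0 sw vS v0 hv.
have := congr1 height es; have := congr1 height et; rewrite !height_sub_roots.
move=> h1 h2; have s0 := ler0n rat (size s); have t0 := ler0n rat (size t).
have /eqP : (size s)%:R = 0 :> rat by lra.
by rewrite pnatr_eq0 size_eq0 es => /eqP ->; rewrite big_nil subr0.
Qed.

End OneRep.

Definition central_action n (V : action R g n) (c : hdual g -> K) (M : 'M[K]_n) :=
  intertwiner V V M /\ forall lambda S, irreducible_hw k V lambda S ->
    forall v, v \in S -> M *m v = c lambda *: v.

(** The projections of a direct sum of subrepresentations are intertwiners. *)
Lemma fdrep_projections n (V : action R g n) : fdrep k V ->
  exists m (lam : 'I_m -> hdual g) S (p : 'I_m -> 'M[K]_n),
  [/\ forall j, irreducible_hw k V (lam j) (S j), forall j v, p j *m v \in S j,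
      \sum_j p j = 1%:M & forall j, intertwiner V V (p j)].
Proof.
move=> [rV [m [lam [S [hS dS sumS]]]]].
pose pi j := sumv_pi_for (esym sumS) j.
have /choice[p hp] : forall j, exists M : 'M[K]_n, forall v, M *m v = pi j v.
  by move=> j; exact: linear_mulmx.
have pS j v : p j *m v \in S j by rewrite hp; apply: memv_sum_pi.
have sum_p (v : 'cV[K]_n) : \sum_j p j *m v = v.
  rewrite (eq_bigr (fun j => pi j v)) => [|j _]; last exact: hp.
  by apply: sumv_pi_sum; rewrite memvf.
have uniq := elimT directv_sum_unique dS.
have comm (A : 'M[K]_n) : (forall j v, v \in S j -> A *m v \in S j) ->
  forall j, p j *m A = A *m p j.
  move=> hA j; apply: mulmx_ext => v; apply/eqP; rewrite -!mulmxA.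
  have := uniq (fun j => p j *m (A *m v)) (fun j => A *m (p j *m v)).
  rewrite sum_p -mulmx_sumr sum_p eqxx => /(_ _ _)/esym/forall_inP h.
  by apply: h => // i _; rewrite ?pS ?hA ?pS.
have stS j : stable V (S j) by case: (hS j).
exists m, lam, S, p; split=> //.
  by apply: mulmx_ext => v; rewrite mulmx_suml mul1mx.
by move=> j; split=> i; apply: comm => l v /stS[].
Qed.

Lemma irreducible_component n (V : action R g n) lambda S (p : 'M[K]_n) mu v :
  fdrep k V -> irreducible_hw k V lambda S -> (forall v, p *m v \in S) ->
  intertwiner V V p -> singular k V mu v -> p *m v != 0 -> lambda = mu.
Proof.
move=> fV hS pS hp sv pv0.
by rewrite (irreducible_singular fV hS (pS v) pv0 (intertwiner_singular hp sv)).
Qed.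

Lemma intertwiner_sum n m (V : action R g n) (W : action R g m) l
    (c : 'I_l -> K) (f : 'I_l -> 'M[K]_(m, n)) :
  (forall j, intertwiner V W (f j)) -> intertwiner V W (\sum_j c j *: f j).
Proof.
move=> h; split=> i; rewrite mulmx_suml mulmx_sumr; apply: eq_bigr => j _;
  by have [hE hF hK] := h j; rewrite -scalemxAl -scalemxAr ?hE ?hF ?hK.
Qed.

(** On each irreducible summand [S j] the operator is the scalar [c (lam j)].
    The singular vector of any irreducible subrepresentation of highest weight
    [lambda] only has components in the [S j] with [lam j = lambda], and the
    vectors on which the operator is [c lambda] form a subrepresentation. *)
Lemma central_action_exists n (V : action R g n) c : fdrep k V ->
  exists M, central_action V c M.
Proof.
move=> fV; have [m [lam [S [p [hS pS sum_p hp]]]]] := fdrep_projections fV.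
pose M := \sum_j c (lam j) *: p j.
have MV : intertwiner V V M by apply: intertwiner_sum.
exists M; split=> // lambda S' hS' v vS'.
have [_ _ _ [w [wS w0 hw Ew]]] := hS'.
have [U hU] := mulmx_ker_vspace (M - (c lambda)%:M).
have sU : stable V U.
  move=> u; rewrite hU => /eqP e; have [mE mF mK] := MV.
  have st (A : 'M[K]_n) : M *m A = A *m M -> A *m u \in U.
    move=> hA; rewrite hU mulmxA mulmxBl hA -scalar_mxC -mulmxBr -mulmxA e.
    by rewrite mulmx0.
  by split=> i; apply: st.
have wU : w \in U.
  rewrite hU mulmxBl mul_scalar_mx -{2}[w]mul1mx -sum_p /M !mulmx_suml.
  rewrite scaler_sumr -sumrB; apply/eqP; rewrite big1 // => j _.
  rewrite -scalemxAl; have [->|pj0] := eqVneq (p j *m w) 0.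
    by rewrite !scaler0 subrr.
  by rewrite (irreducible_component fV (hS j) (pS j) (hp j) (conj hw Ew)) ?subrr.
have /subvP/(_ v vS') := irreducible_sub hS' sU wS wU w0.
by rewrite hU mulmxBl mul_scalar_mx subr_eq0 => /eqP.
Qed.

Lemma central_opP n (V : action R g n) c : fdrep k V ->
  central_action V c (central_op k V c).
Proof.
move=> fV; have [M hM] := central_action_exists c fV.
by have := xgetPex 0 (ex_intro _ M hM :
  exists M, [set M : 'M[K]_n | central_action V c M]%classic M).
Qed.

(** The components of the vector in the irreducible summands are singular of the
    same weight, so they vanish except where the highest weight is [lambda]. *)
Lemma central_op_singular n (V : action R g n) c lambda v : fdrep k V ->
  singular k V lambda v -> central_op k V c *m v = c lambda *: v.
Proof.
move=> fV sv; have [_ hc] := central_opP c fV.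
have [m [lam [S [p [hS pS sum_p hp]]]]] := fdrep_projections fV.
rewrite -[v]mul1mx -sum_p mulmx_suml mulmx_sumr scaler_sumr.
apply: eq_bigr => j _; rewrite (hc _ _ (hS j)) //.
have [->|pj0] := eqVneq (p j *m v) 0; first by rewrite !scaler0.
by rewrite (irreducible_component fV (hS j) (pS j) (hp j) sv).
Qed.

Lemma central_op_intertwine n m (V : action R g n) (W : action R g m) c f :
  fdrep k V -> fdrep k W -> intertwiner V W f ->
  f *m central_op k V c = central_op k W c *m f.
Proof.
move=> fV fW hf; have [hV _] := central_opP c fV; have [hW _] := central_opP c fW.
apply: (fdrep_ext fV (intertwiner_comp hV hf) (intertwiner_comp hf hW) _) => mu v sv.
rewrite -!mulmxA (central_op_singular _ fV sv) -scalemxAr.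
by rewrite (central_op_singular _ fW (intertwiner_singular hf sv)).
Qed.

(** The inverse acts by the inverse scalars, which is checked on singular
    vectors. *)
Lemma central_op_unit n (V : action R g n) c : fdrep k V ->
  (forall lambda, c lambda != 0) -> central_op k V c \in unitmx.
Proof.
move=> fV c0; pose c' lambda := (c lambda)^-1.
have [hV _] := central_opP c fV; have [hV' _] := central_opP c' fV.
have e : central_op k V c *m central_op k V c' = 1%:M.
  apply: (fdrep_ext fV (intertwiner_comp hV' hV) (intertwiner1 V) _) => mu v sv.
  rewrite -mulmxA (central_op_singular _ fV sv) -scalemxAr.
  by rewrite (central_op_singular _ fV sv) scalerA mulVf ?c0 // scale1r mul1mx.
by have [uc _] := mulmx1_unit e.
Qed.

(** The operator may fail to exist on a representation that is not completely
    reducible; the default value [0] is then an intertwiner as well. *)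
Lemma central_op_intertwiner n (V : action R g n) c :
  intertwiner V V (central_op k V c).
Proof.
rewrite /central_op; case: xgetP => [M _ []//|_].
by split=> i; rewrite mul0mx mulmx0.
Qed.

End Central.

(** * The operators J and T_w *)

Section Form.
Variables (R : realType) (g : simple_datum) (k : nat).
Hypothesis hk : sufficiently_divisible g k.
Implicit Types mu nu : hdual g.

Lemma bformE mu nu : bform mu nu =
  \sum_i mu 0 i * ((dlen i)%:R * pairing (coroot i) nu).
Proof.
apply: eq_bigr => i _; rewrite /pairing !mulr_sumr; apply: eq_bigr => j _.
by rewrite mxE intrM; ring.
Qed.

Lemma bformC mu nu : bform mu nu = bform nu mu.
Proof.
rewrite /bform exchange_big; apply: eq_bigr => i _; apply: eq_bigr => j _ /=.
by rewrite cartan_symm; ring.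
Qed.

Lemma bformDr mu nu nu' : bform mu (nu + nu') = bform mu nu + bform mu nu'.
Proof.
rewrite !bformE -big_split; apply: eq_bigr => i _.
by rewrite pairingD /=; ring.
Qed.

Lemma bformZr mu c nu : bform mu (c *: nu) = c * bform mu nu.
Proof.
by rewrite !bformE mulr_sumr; apply: eq_bigr => i _; rewrite pairingZ; ring.
Qed.

Lemma bformDl mu mu' nu : bform (mu + mu') nu = bform mu nu + bform mu' nu.
Proof. by rewrite bformC bformDr !(bformC nu). Qed.

Lemma bformZl mu c nu : bform (c *: mu) nu = c * bform mu nu.
Proof. by rewrite bformC bformZr bformC. Qed.

Lemma bform_alpha i nu : bform (alpha i) nu = (dlen i)%:R * pairing (coroot i) nu.
Proof.
rewrite bformE (bigD1 i) //= big1 => [|j ji]; last first.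
  by rewrite mxE eqxx (negbTE ji) mul0r.
by rewrite mxE !eqxx mul1r addr0.
Qed.

Lemma bform_srefl i mu nu : bform (srefl i mu) (srefl i nu) = bform mu nu.
Proof.
rewrite /srefl -!scaleNr !(bformDl, bformDr, bformZl, bformZr) (bformC mu (alpha i)).
by rewrite !bform_alpha pairing_coroot_alpha cartan_diag; ring.
Qed.

Lemma bform_wact s mu nu : bform (wact s mu) (wact s nu) = bform mu nu.
Proof. by elim: s => //= i s IH; rewrite bform_srefl. Qed.

Variables (rho : hdual g).
Hypothesis hrho : forall i, bform (alpha i) rho = (dlen i)%:R.

Definition jexp mu : rat := bform mu mu / 2 + bform mu rho.

(** The normalization of [rho] makes [(mu, rho)] an integral combination of the
    coordinates of [mu], and these are values of fundamental coweights. *)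
Lemma kint_jexp mu : weight mu -> kint k (jexp mu).
Proof.
move=> wmu; apply: kintD; first by rewrite /kint; case: hk => _ _ h; apply: h.
rewrite /kint bformE mulr_sumr rpred_sum // => i _.
rewrite -bform_alpha hrho mulrA rpredM ?rpred_nat //.
by have := kint_pairing hk (delta_mx 0 i) wmu; rewrite pairing_delta.
Qed.

Lemma jexpD mu nu : jexp (mu + nu) = jexp mu + jexp nu + bform mu nu.
Proof.
by rewrite /jexp !(bformDl, bformDr) (bformC nu mu); field.
Qed.

Lemma kint_bform mu nu : weight mu -> weight nu -> kint k (bform mu nu).
Proof.
move=> wmu wnu; have -> : bform mu nu = jexp (mu + nu) - (jexp mu + jexp nu).
  by rewrite jexpD; ring.
by apply: kintD; rewrite ?kint_jexp //; [exact: weightD|apply/kintN/kintD; exact: kint_jexp].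
Qed.

Section JOperator.
Variables (n : nat) (V : action R g n).
Hypothesis wm : weight_module k V.

Lemma J_weight_vector mu v : weight_vector k V mu v -> J k rho V *m v = qpow R k (jexp mu) *: v.
Proof.
move=> hv; rewrite /J (weight_opP hk wm _ hv) // => {hv} nu c u w.
by rewrite scalerDr !scalerA mulrC.
Qed.

Lemma J_unit : J k rho V \in unitmx.
Proof.
pose J' := weight_op k V (fun mu v => (qpow R k (jexp mu))^-1 *: v).
have e : J k rho V *m J' = 1%:M.
  apply: (weight_module_ext wm) => mu v hv; rewrite -mulmxA (weight_opP hk wm _ hv).
    by rewrite -scalemxAr (J_weight_vector hv) scalerA mulVf ?qpow_neq0 // scale1r mul1mx.
  by move=> nu c u w; rewrite scalerDr !scalerA mulrC.
by have [uJ _] := mulmx1_unit e.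
Qed.

End JOperator.

Lemma J_intertwine n m (V : action R g n) (W : action R g m) f :
  weight_module k V -> weight_module k W -> intertwiner V W f ->
  f *m J k rho V = J k rho W *m f.
Proof.
move=> wV wW [_ _ fK]; apply: (weight_module_ext wV) => mu v hv.
have hfv : weight_vector k W mu (f *m v).
  by case: hv => wmu hv; split=> // H; rewrite mulmxA -fK -mulmxA hv scalemxAr.
by rewrite -!mulmxA (J_weight_vector wV hv) (J_weight_vector wW hfv) scalemxAr.
Qed.

End Form.

Section LongWord.
Variables (R : realType) (g : simple_datum) (k : nat).
Hypothesis hk : sufficiently_divisible g k.
Implicit Types s : seq 'I_(rank g).

Lemma Tword_intertwine n m (V : action R g n) (W : action R g m) f s :
  weight_module k V -> weight_module k W -> intertwiner V W f ->
  f *m Tword k s V = Tword k s W *m f.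
Proof.
move=> wV wW hf; elim: s => [|i s IH]; first by rewrite mulmx1 mul1mx.
by rewrite /= mulmxA (T_intertwine hk i wV wW hf) -mulmxA IH mulmxA.
Qed.

Lemma weight_vector_Tword n (V : action R g n) s mu v : weight_module k V ->
  weight_vector k V mu v ->
  weight_vector k V (wact s mu) (Tword k s V *m v).
Proof.
move=> wV hv; elim: s => [|i s IH]; first by rewrite mul1mx.
by rewrite /= -mulmxA; apply: (weight_vector_T hk wV).
Qed.

Lemma Tword_unit n (V : action R g n) s : is_rep k V -> weight_module k V ->
  Tword k s V \in unitmx.
Proof.
move=> rV wV; elim: s => [|i s IH]; first exact: unitmx1.
rewrite /= unitmx_mul IH andbT; apply: unitmx_inj => v.
exact: (T_inj hk rV wV).
Qed.

End LongWord.

(** * Tensor products *)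

Section Tensor.
Variables (R : realType) (g : simple_datum) (k : nat).
Hypothesis hk : sufficiently_divisible g k.
Local Notation K := (Kq R).
Local Notation qp := (qpow R k).
Variables (n m : nat) (V : action R g n) (W : action R g m).

(** An intertwiner of each factor also commutes with the group-like parts of the
    coproduct. *)
Lemma tensor_intertwiner (f : 'M[K]_n) (h : 'M[K]_m) :
  intertwiner V V f -> intertwiner W W h ->
  intertwiner (tensor V W) (tensor V W) (f *t h).
Proof.
move=> [fE fF fK] [hE hF hK]; split=> i /=.
- by rewrite mulmxDl mulmxDr !tensmx_mul fE hE /actKi hK mulmx1 mul1mx.
- rewrite mulmxDl mulmxDr !tensmx_mul fF hF mulmx1 mul1mx.
  by rewrite (invmx_comm (fK _)).
- by rewrite !tensmx_mul fK hK.
Qed.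

Hypotheses (rV : is_rep k V) (rW : is_rep k W).
Hypotheses (wV : weight_module k V) (wW : weight_module k W).

Lemma tensor_shift : weight_shift k (tensor V W).
Proof.
have KK l (U : action R g l) : is_rep k U -> forall H H',
    actK U H *m actK U H' = actK U H' *m actK U H.
  by move=> rU H H'; rewrite !(rep_KD rU) addrC.
split=> H j /=.
- rewrite mulmxDr mulmxDl !tensmx_mul mulmx1 mul1mx (ws_KE wV) (ws_KE wW).
  by rewrite /actKi (KK _ _ rW H) tensmxZl tensmxZr scalerDr.
- rewrite mulmxDr mulmxDl !tensmx_mul mulmx1 mul1mx (ws_KF wV) (ws_KF wW).
  by rewrite (invmx_comm (KK _ _ rV H _)) tensmxZl tensmxZr scalerDr.
Qed.

Lemma tensor_weight_vector mu nu (v : 'cV[K]_n) (w : 'cV[K]_m) :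
  weight_vector k V mu v -> weight_vector k W nu w ->
  weight_vector k (tensor V W) (mu + nu) (tenscv v w).
Proof.
move=> [wmu hv] [wnu hw]; split=> [|H]; first exact: weightD.
rewrite /= tenscv_mul hv hw tenscvZ pairingD.
by rewrite qpowD //; exact: kint_pairing.
Qed.

Lemma tensor_weight_module : weight_module k (tensor V W).
Proof.
split; first exact: tensor_shift.
have [P [wP [uP hP]]] := wm_span wV; have [S [wS [uS hS]]] := wm_span wW.
exists (P *t S).
exists (fun j => wP (mxtens_unindex j).1 + wS (mxtens_unindex j).2).
split=> [|j]; first exact: (tensmx_unitmx uP uS).
by rewrite col_tensmx; apply: tensor_weight_vector.
Qed.

Lemma tensor_ext l (A B : 'M[K]_(l, n * m)) :
  (forall mu nu (v : 'cV[K]_n) (w : 'cV[K]_m),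
    weight_vector k V mu v -> weight_vector k W nu w ->
    A *m (tenscv v w) = B *m (tenscv v w)) -> A = B.
Proof.
move=> h.
have [P [wP [uP hP]]] := wm_span wV; have [S [wS [uS hS]]] := wm_span wW.
have uPS := tensmx_unitmx uP uS.
rewrite -(mulmxK uPS A) -(mulmxK uPS B); congr (_ *m _).
apply/matrixP => a j; have := h _ _ _ _ (hP (mxtens_unindex j).1) (hS (mxtens_unindex j).2).
by rewrite -col_tensmx => /matrixP/(_ a 0); rewrite !colE !mulmxA -!colE [LHS]mxE [RHS]mxE.
Qed.

Lemma Theta_unique (M : 'M[K]_(n * m)) :
  (forall mu nu (v : 'cV[K]_n) (w : 'cV[K]_m),
    weight_vector k V mu v -> weight_vector k W nu w ->
    M *m (tenscv v w) =
      qp (bform mu nu) *: (tenscv v w)) -> Theta k V W = M.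
Proof.
move=> hM; have hT := xgetPex 0 (ex_intro _ M hM :
  exists M, [set M : 'M[K]_(n * m) | forall mu nu (v : 'cV[K]_n) (w : 'cV[K]_m),
    weight_vector k V mu v -> weight_vector k W nu w ->
    M *m (tenscv v w) =
      qp (bform mu nu) *: (tenscv v w)]%classic M).
by apply: tensor_ext => mu nu v w hv hw; rewrite (hM _ _ _ _ hv hw); apply: hT.
Qed.

Variable rho : hdual g.
Hypothesis hrho : forall i, bform (alpha i) rho = (dlen i)%:R.

(** The polarization identity (mu + nu, mu + nu) / 2 - (mu, mu) / 2
    - (nu, nu) / 2 = (mu, nu). *)
Lemma J_coboundary_weight_vector mu nu (v : 'cV[K]_n) (w : 'cV[K]_m) :
  weight_vector k V mu v -> weight_vector k W nu w ->
  ((invmx (J k rho V) *t invmx (J k rho W)) *m J k rho (tensor V W))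
     *m (tenscv v w) =
  qp (bform mu nu) *: (tenscv v w).
Proof.
move=> hv hw; have [wmu _] := hv; have [wnu _] := hw.
rewrite -mulmxA (J_weight_vector hk rho tensor_weight_module (tensor_weight_vector hv hw)) -scalemxAr.
rewrite tenscv_mul (invmx_eigen (J_unit hk rho wV) (qpow_neq0 _ _ _) (J_weight_vector hk rho wV hv)).
rewrite (invmx_eigen (J_unit hk rho wW) (qpow_neq0 _ _ _) (J_weight_vector hk rho wW hw)).
rewrite tenscvZ !scalerA; congr (_ *: _).
have km := kint_jexp hk hrho wmu; have kn := kint_jexp hk hrho wnu.
have kb := kint_bform hk hrho wmu wnu.
rewrite jexpD (qpowD _ (kintD km kn) kb) (qpowD _ km kn) {km kn kb}.
have := qpow_neq0 R k (jexp rho mu); have := qpow_neq0 R k (jexp rho nu).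
move: (qp (jexp rho mu)) (qp (jexp rho nu)) (qp (bform mu nu)) => a b c b0 a0.
exact: (mulf_cancel3 c a0 b0).
Qed.

Lemma ThetaE : Theta k V W =
  (invmx (J k rho V) *t invmx (J k rho W)) *m J k rho (tensor V W).
Proof. by apply: Theta_unique => mu nu v w; apply: J_coboundary_weight_vector. Qed.

(** [T_w] maps the weight space of [mu] to that of [w mu], and the form is
    Weyl-invariant. *)
Lemma Tword_Theta s :
  (Tword k s V *t Tword k s W) *m Theta k V W =
  Theta k V W *m (Tword k s V *t Tword k s W).
Proof.
apply: tensor_ext => mu nu v w hv hw; rewrite -!mulmxA tenscv_mul ThetaE.
have TV := weight_vector_Tword hk s wV hv; have TW := weight_vector_Tword hk s wW hw.
rewrite (J_coboundary_weight_vector hv hw) (J_coboundary_weight_vector TV TW) bform_wact.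
by rewrite -scalemxAr tenscv_mul.
Qed.

Lemma inv_Tword_Theta s :
  (invmx (Tword k s V) *t invmx (Tword k s W)) *m Theta k V W =
  Theta k V W *m (invmx (Tword k s V) *t invmx (Tword k s W)).
Proof.
have uV := Tword_unit hk s rV wV; have uW := Tword_unit hk s rW wW.
exact: left_inverse_comm (tensmx_invmx uV uW) (Tword_Theta s).
Qed.

End Tensor.

(** * The element Y *)

Section YElement.
Variables (R : realType) (g : simple_datum) (k : nat).
Hypothesis hk : sufficiently_divisible g k.
Variable rho : hdual g.
Hypothesis hrho : forall i, bform (alpha i) rho = (dlen i)%:R.
Variable s : seq 'I_(rank g).

Lemma Qhalf_unit n (V : action R g n) : fdrep k V -> Qhalf k rho V \in unitmx.
Proof. by move=> fV; apply: (central_op_unit hk fV) => lambda; apply: qpow_neq0. Qed.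

Lemma Y_unit n (V : action R g n) : fdrep k V -> Y k rho s V \in unitmx.
Proof.
move=> fV; have wV := fdrep_weight_module hk fV.
have uT := Tword_unit hk s (fdrep_rep fV) wV; have uJ := J_unit hk rho wV.
have uQ := Qhalf_unit fV.
by rewrite /Y /mul1 /inv1 !unitmx_mul unitmx_inv uQ uJ uT.
Qed.

Lemma Y_intertwine n m (V : action R g n) (W : action R g m) f :
  fdrep k V -> fdrep k W -> intertwiner V W f -> f *m Y k rho s V = Y k rho s W *m f.
Proof.
move=> fV fW hf; have wV := fdrep_weight_module hk fV; have wW := fdrep_weight_module hk fW.
have eQ := invmx_intertwine (Qhalf_unit fV) (Qhalf_unit fW)
  (central_op_intertwine hk _ fV fW hf).
have eJ := J_intertwine hk rho wV wW hf; have eT := Tword_intertwine hk s wV wW hf.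
exact: intertwine_mul eQ (intertwine_mul eJ eT).
Qed.

Lemma Y_invertible : invertible_in_completion k (Y k rho s : op1 R g).
Proof.
split=> [n m V W f fV fW hf|n m V W f fV fW hf|n V fV].
- exact: Y_intertwine.
- exact: invmx_intertwine (Y_unit fV) (Y_unit fW) (Y_intertwine fV fW hf).
- by rewrite /inv1 (mulmxV (Y_unit fV)) (mulVmx (Y_unit fV)).
Qed.

Lemma inv_YE n (V : action R g n) : fdrep k V ->
  inv1 (Y k rho s) V =
  invmx (Tword k s V) *m (invmx (J k rho V) *m Qhalf k rho V).
Proof.
move=> fV; have wV := fdrep_weight_module hk fV.
have uT := Tword_unit hk s (fdrep_rep fV) wV; have uJ := J_unit hk rho wV.
have uQ := Qhalf_unit fV.
exact: (invmx_mul3 uQ uJ uT).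
Qed.

Lemma Rbar_coboundary n m (V : action R g n) (W : action R g m) :
  fdrep k V -> fdrep k W ->
  Rbar k rho s V W =
  mul2 (otimes (inv1 (Y k rho s)) (inv1 (Y k rho s))) (Delta (Y k rho s)) V W.
Proof.
move=> fV fW; have wV := fdrep_weight_module hk fV; have wW := fdrep_weight_module hk fW.
have rV := fdrep_rep fV; have rW := fdrep_rep fW.
have wVW := tensor_weight_module hk rV rW wV wW.
rewrite /Rbar /Rmat /mul2 /otimes /Delta !inv_YE // -!tensmx_mul.
have iQQ : intertwiner (tensor V W) (tensor V W) (Qhalf k rho V *t Qhalf k rho W).
  by apply: tensor_intertwiner; apply: central_op_intertwiner.
have iQt : intertwiner (tensor V W) (tensor V W) (Qhalf k rho (tensor V W)).
  exact: central_op_intertwiner.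
apply: unitarization_algebra.
- by rewrite (ThetaE hk rV rW wV wW hrho).
- exact: (inv_Tword_Theta hk rV rW wV wW hrho s).
- exact: (J_intertwine hk rho wVW wVW iQQ).
- exact: (Tword_intertwine hk s wVW wVW iQQ).
- by apply/esym/invmx_comm/esym; exact: (J_intertwine hk rho wVW wVW iQt).
- by apply/esym/invmx_comm/esym; exact: (Tword_intertwine hk s wVW wVW iQt).
Qed.

End YElement.

Theorem theorem7p5 (R : realType) (g : simple_datum) (k : nat)
    (hk : sufficiently_divisible g k)
    (rho : hdual g) (hrho : forall i, bform (alpha i) rho = (dlen i)%:R)
    (s : seq 'I_(rank g)) (hs : reduced_longest s) :
  invertible_in_completion k (Y k rho s : op1 R g) /\
  forall (n m : nat) (V : action R g n) (W : action R g m),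
    fdrep k V -> fdrep k W ->
    Rbar k rho s V W =
      mul2 (otimes (inv1 (Y k rho s)) (inv1 (Y k rho s)))
           (Delta (Y k rho s)) V W.
Proof.
split; first exact: Y_invertible.
exact: Rbar_coboundary.
Qed.
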